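(* With the notation of the context (the normal form Hamiltonian $H^{(1)}$ of the finite periodic Klein--Gordon chain, the generalized dNLS Hamiltonian $K_{\rm eff}$, the thresholds $\epsilon_*$, $\rho_*$, and the constant $\kappa_0$), let $\epsilon\in(0,\epsilon_* )$ and $0<\rho<\rho_*$. Let $z(t)$ be the solution of Hamilton's equations of $H^{(1)}$ with $z(0)=z_0$, let $z_a(t)$ be a solution of Hamilton's equations of $K_{\rm eff}$, and set $\delta(t):=z(t)-z_a(t)$, $\delta_0:=\delta(0)$. (i) Consider the two independent parameters $\rho$ and $\epsilon$ in the regime $\epsilon^3\ll\rho\leq\epsilon^2$. Then there exists a positive constant $\mathsf{C}$ independent of $\rho$ and $\epsilon$ such that for any initial datum $z_0\in B_{\frac23\rho^{1/2}}$ with $\|\delta_0\|\leq\rho^{-1/2}\epsilon^3$, $$\|\delta(t)\|\leq\mathsf{C}\,\rho^{-1/2}\epsilon^3,\qquad |t|\leq T_0:=\frac1\rho.$$ (ii) Let $\alpha\in(0,1)$ be arbitrary and consider the two independent parameters $\rho$ and $\epsilon$ in the regime $\epsilon^{\frac{3}{1+\alpha}}\ll\rho\leq\epsilon^2$. Then there exists a positive constant $\mathsf{C}$ independent of $\rho$ and $\epsilon$ such that for any initial datum $z_0\in B_{\frac23\rho^{1/2}}$ with $\|\delta_0\|\leq\rho^{-1/2}\epsilon^3$, $$\|\delta(t)\|\leq\mathsf{C}\,\rho^{-1/2-\alpha}\epsilon^3,\qquad |t|\leq T_0^*:=\frac{\alpha}{\kappa_0\rho}\ln\left(\frac1\rh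o\right).$$
   Context: **Asymptotic notation.** For the positive parameters $\rho,\epsilon$, $f\ll g$ means that $f/g$ is sufficiently small (below a threshold independent of $\rho,\epsilon$). **The chain.** Fix $N\geq2$. The finite periodic discrete Klein--Gordon chain has Hamiltonian $H=H_0+H_1$, $$H_0=\tfrac12\sum_{j=-N}^N\left[y_j^2+x_j^2-2\epsilon x_{j+1}x_j\right],\qquad H_1=\tfrac14\sum_{j=-N}^Nx_j^4,$$ with periodic boundary conditions (indices mod $2N+1$), in canonical variables $(x,y)\in\mathbb{R}^{2(2N+1)}$. The phase space carries the Euclidean norm $\|\cdot\|$, and $B_R$ is the ball of radius $R$ centred at $0$. **Seeds and norms.** Let $\tau$ be the cyclic permutation $\tau(x_{-N},\dots,x_N)=(x_{-N+1},\dots,x_N,x_{-N})$, acting on functions by $(\tau f)(x,y)=f(\tau x,\tau y)$. For a function $f$ (a seed) put $f^\oplus:=\sum_{l=-N}^N\tau^lf$; such functions are cyclically symmetric. A seed $f$ is centered aligned if $f=\sum_{m=0}^Nf^{(m)}$ with $f^{(m)}$ depending only on variables with index in $\{-m,\dots,m\}$. For a homogeneous polynomial, $\|f\|$ denotes the sum of absolute values of its coefficients. A centered aligned seed $f$ is of class $\mathcal{D}(C_f,\mu)$, with $C_f>0$ and $0<\mu<1$, if $\|f^{(m)}\|\leq C_f\mu^m$ for $m=0,\dots,N$. **Linear transformation.** Let $A=\mathbb{I}-\epsilon(\tau+\tau^\top)$, where $\tau$ also denotes the permutation matrix, $\tau_{ij}=\delta_{i,j+1\,({\rm mod}\,2N+1)}$.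 In the canonical variables $q=A^{1/4}x$, $p=A^{-1/4}y$ one has $H_0=\frac12p^\top A^{1/2}p+\frac12q^\top A^{1/2}q=H_\Omega+Z_0$, where $H_\Omega=\frac{\Omega}{2}\sum_j(q_j^2+p_j^2)$, $\Omega=(A^{1/2})_{11}$ is the average of the normal-mode frequencies (eigenvalues of $A^{1/2}$), and $Z_0$ is the off-diagonal part, with centered aligned seed $\zeta_0=\sum_{m=1}^N\zeta_0^{(m)}$ of class $\mathcal{D}(C_{\zeta_0},2\epsilon)$, where $\zeta_0^{(m)}$ carries the coupling between sites at distance $m$, with coefficient $b_m:=(A^{1/2})_{1,m+1}=O(\epsilon^m)$. In these variables $H_1=h_1^\oplus$ with a centered aligned seed $h_1$ of class $\mathcal{D}(C_{h_1},2\epsilon)$. **Thresholds.** Let $$f(\epsilon)=\frac{3\Omega}{64C_{\zeta_0}}\,\frac{(1-2\epsilon)\left[1-(2\epsilon)^{3/4}\right]}{\sqrt{2\epsilon}}.$$ The number $\epsilon_*<\frac12$ is such that $f(\epsilon)>1$ for $\epsilon\in(0,\epsilon_* )$. Put $$\gamma=2\Omega\left(1-\frac1{2f(\epsilon)}\right),\qquad C_*=\frac{4C_{h_1}}{3\gamma(1-2\epsilon)\left[1-(2\epsilon)^{3/4}\right]},\qquad \rho_*=\frac1{96(1+e)C_*}.$$ **Normal form (known fact).** For $\epsilon\in(0,\epsilon_* )$ there is a cyclically symmetric generating function $\mathcal{X}_1$ whose Lie transform $T_{\mathcal{X}_1}$ satisfies $T_{\mathcal{X}_1}H^{(1)}=H$,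 with $$H^{(1)}=H_\Omega+Z_0+Z_1+P^{(2)},\qquad \{H_\Omega,Z_0\}=\{H_\Omega,Z_1\}=0,$$ where $Z_1=\zeta_1^\oplus$ is a quartic polynomial with seed $\zeta_1=\sum_{m=0}^N\zeta_1^{(m)}$ of class $\mathcal{D}(C_{h_1},2\epsilon)$. For $0<\rho<\rho_*$, $T_{\mathcal{X}_1}$ defines an analytic canonical transformation on $B_{\frac23\rho^{1/2}}$, with $\|T_{\mathcal{X}_1}^{\pm1}(z)-z\|\leq4^4C_*\rho^{3/2}$ for $z$ in that ball. The remainder $P^{(2)}=\sum_{s\geq2}H^{(1)}_s$ is analytic there; each $H_s^{(1)}$ is a cyclically symmetric homogeneous polynomial of degree $2s+2$ with seed of class $\mathcal{D}(2\tilde C_*^{\,s-1}C_{h_1},\sqrt{2\epsilon})$ for a constant $\tilde C_*$. This $H^{(1)}$ is the one used in the claim. **The generalized dNLS Hamiltonian.** Put $Z_0^{(m)}=(\zeta_0^{(m)})^\oplus$ and $Z_1^{(m)}=(\zeta_1^{(m)})^\oplus$. The effective Hamiltonian is $K_{\rm eff}:=H_\Omega+Z_0^{(1)}+Z_0^{(2)}+Z_1^{(0)}$. In complex coordinates $\psi_j=(q_j+ip_j)/\sqrt2$ it reads $$K_{\rm eff}=(\Omega+2b_1+2b_2)\sum_j|\psi_j|^2-b_1\sum_j|\psi_{j+1}-\psi_j|^2-b_2\sum_j|\psi_{j+2}-\psi_j|^2+\frac38\sum_j|\psi_j|^4,$$ and its equations of motion are $i\dot\psi_j=\Omega\psi_j+b_1(\psi_{j+1}+\psi_{j-1})+b_2(\psi_{j+2}+\psi_{j-2})+\frac34\psi_j|\psi_j|^2$.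 **The constant $\kappa_0$.** Let $X_N$ be the Hamiltonian vector field of $Z_1+P^{(2)}$. There is a constant $\mathsf{C}_1$, independent of $\rho$ and $\epsilon$, such that the norm of its differential $X_N'$ at points of norm of order $\rho^{1/2}$ is at most $\mathsf{C}_1C_{h_1}\rho/(1-(2\epsilon)^{1/4})^2$. Put $\kappa_0:=\mathsf{C}_1C_{h_1}/(1-(2\epsilon_* )^{1/4})^2$. *)

(* Defs.v *)
From HB Require Import structures.
From mathcomp Require Import all_boot all_order all_algebra.
From mathcomp Require Import all_classical all_reals all_analysis.
(* The notations of mpoly clash with those of mathcomp-analysis. *)
From mathcomp Require Export -(notations) mpoly.

Set Implicit Arguments.
Unset Strict Implicit.
Unset Printing Implicit Defensive.

Import Order.TTheory GRing.Theory Num.Theory numFieldNormedType.Exports.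
Local Open Scope classical_set_scope.
Local Open Scope ring_scope.

(* The sites -N..N, with indices mod 2N+1, are represented by 'I_(2N+1):
   the site j < 0 is the ordinal 2N+1+j.  A phase point is the row vector
   (q, p); the polynomial variables are indexed in the same way. *)
Notation sites N := (N.*2.+1) (only parsing).
Notation phase R N := 'rV[R]_(sites N + sites N) (only parsing).
Notation hpoly R N := (mpoly (sites N + sites N) R) (only parsing).

Definition enorm (R : realType) (n : nat) (z : 'rV[R]_n) : R :=
  Num.sqrt (\sum_(i < n) z 0 i ^+ 2).

Definition ev (R : realType) (n : nat) (f : mpoly n R) (z : 'rV[R]_n) : R :=
  meval (fun i => z 0 i) f.

Definition polynorm (R : realType) (n : nat) (f : mpoly n R) : R :=
  \sum_(m <- msupp f) `|mcoeff m f|.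

Definition homog (R : realType) (n : nat) (d : nat) (f : mpoly n R) : bool :=
  f \is ishomog1 d mdeg.

Definition var (R : realType) (n : nat) (i : 'I_n) : mpoly n R :=
  mpolyX R (mnm1 i).

Definition Xq (R : realType) (N : nat) (j : 'I_(sites N)) : hpoly R N :=
  var R (lshift (sites N) j).
Definition Xp (R : realType) (N : nat) (j : 'I_(sites N)) : hpoly R N :=
  var R (rshift (sites N) j).

Definition substqp (R : realType) (N : nat)
    (F G : 'I_(sites N) -> hpoly R N) (f : hpoly R N) : hpoly R N :=
  comp_mpoly [tuple match fintype.split i with inl j => F j | inr j => G j end
             | i < sites N + sites N] f.

Definition ctau (R : realType) (N : nat) (f : hpoly R N) : hpoly R N :=
  substqp (fun j => Xq R (ordS j)) (fun j => Xp R (ordS j)) f.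

(* tau has order 2N+1, so that the sum over l = 0..2N is that over -N..N. *)
Definition cyc (R : realType) (N : nat) (f : hpoly R N) : hpoly R N :=
  \sum_(l < sites N) iter l (@ctau R N) f.

Definition cyclically_symmetric (R : realType) (N : nat) (f : hpoly R N) :=
  exists g : hpoly R N, f = cyc g.

Definition site_dist (N : nat) (j : 'I_(sites N)) : nat := minn j (sites N - j).

Definition supported_within (R : realType) (N m : nat) (f : hpoly R N) : Prop :=
  forall mon, mon \in msupp f -> forall j : 'I_(sites N),
    (mon (lshift (sites N) j) != 0%N) || (mon (rshift (sites N) j) != 0%N) ->
    (site_dist j <= m)%N.

(* A centered aligned seed is given by its components f^(0), .., f^(N). *)
Definition seed_sum (R : realType) (N : nat) (f : nat -> hpoly R N) : hpoly R N :=
  \sum_(m < N.+1) f m.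

Definition classD (R : realType) (N d : nat) (C mu : R) (f : nat -> hpoly R N) :=
  [/\ 0 < C, 0 < mu < 1 &
    forall m, (m <= N)%N ->
      [/\ homog d (f m), supported_within m (f m) &
          polynorm (f m) <= C * mu ^+ m]].

(* In the original variables of the chain Xq stands for x, and Xp for y. *)
Definition H0_xy (R : realType) (N : nat) (eps : R) : hpoly R N :=
  2^-1 *: \sum_(j < sites N)
    (Xp R j ^+ 2 + Xq R j ^+ 2 - (2 * eps) *: (Xq R (ordS j) * Xq R j)).

Definition H1_xy (R : realType) (N : nat) : hpoly R N :=
  4^-1 *: \sum_(j < sites N) Xq R j ^+ 4.

Definition tau_mx (R : realType) (N : nat) : 'M[R]_(sites N) :=
  \matrix_(i, j) (i == ordS j)%:R.

Definition A_mx (R : realType) (N : nat) (eps : R) : 'M[R]_(sites N) :=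
  1%:M - eps *: (tau_mx R N + (tau_mx R N)^T).

(* The unique positive semidefinite square root, when there is one. *)
Definition mxsqrt (R : realType) (n : nat) (M : 'M[R]_n) : 'M[R]_n :=
  xget 0 [set S : 'M[R]_n | [/\ S^T = S,
    (forall v : 'rV[R]_n, 0 <= (v *m S *m v^T) 0 0) & S *m S = M]].

Definition A12 (R : realType) (N : nat) (eps : R) := mxsqrt (A_mx N eps).
Definition A14 (R : realType) (N : nat) (eps : R) := mxsqrt (A12 N eps).

(* x = A^(-1/4) q and y = A^(1/4) p *)
Definition to_qp (R : realType) (N : nat) (eps : R) : hpoly R N -> hpoly R N :=
  substqp (fun j => \sum_k invmx (A14 N eps) j k *: Xq R k)
        (fun j => \sum_k A14 N eps j k *: Xp R k).

Definition H0 (R : realType) (N : nat) (eps : R) : hpoly R N :=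
  to_qp eps (H0_xy N eps).
Definition H1 (R : realType) (N : nat) (eps : R) : hpoly R N :=
  to_qp eps (H1_xy R N).

Definition Omega (R : realType) (N : nat) (eps : R) : R := A12 N eps ord0 ord0.
Definition b_coef (R : realType) (N : nat) (eps : R) (m : nat) : R :=
  A12 N eps ord0 (inord m).

Definition HOmega (R : realType) (N : nat) (eps : R) : hpoly R N :=
  (Omega N eps / 2) *: \sum_(j < sites N) (Xq R j ^+ 2 + Xp R j ^+ 2).

Definition zeta0 (R : realType) (N : nat) (eps : R) (m : nat) : hpoly R N :=
  if m == 0%N then 0
  else b_coef N eps m *: (Xq R ord0 * Xq R (inord m) + Xp R ord0 * Xp R (inord m)).

Definition Z0 (R : realType) (N : nat) (eps : R) : hpoly R N :=
  cyc (seed_sum (zeta0 N eps)).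

Definition f_thr (R : realType) (N : nat) (Czeta0 eps : R) : R :=
  3 * Omega N eps / (64 * Czeta0) *
  ((1 - 2 * eps) * (1 - (2 * eps) `^ (3 / 4)) / Num.sqrt (2 * eps)).

Definition gamma (R : realType) (N : nat) (Czeta0 eps : R) : R :=
  2 * Omega N eps * (1 - (2 * f_thr N Czeta0 eps)^-1).

Definition Cstar (R : realType) (N : nat) (Czeta0 Ch1 eps : R) : R :=
  4 * Ch1 / (3 * gamma N Czeta0 eps * (1 - 2 * eps) *
             (1 - (2 * eps) `^ (3 / 4))).

Definition rho_star (R : realType) (N : nat) (Czeta0 Ch1 eps : R) : R :=
  (96 * (1 + expR 1) * Cstar N Czeta0 Ch1 eps)^-1.

Definition kappa0 (R : realType) (C1 Ch1 eps_star : R) : R :=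
  C1 * Ch1 / (1 - (2 * eps_star) `^ (1 / 4)) ^+ 2.

Definition pbracket (R : realType) (N : nat) (f g : hpoly R N) : hpoly R N :=
  \sum_(j < sites N)
    (mderiv (lshift (sites N) j) f * mderiv (rshift (sites N) j) g
     - mderiv (rshift (sites N) j) f * mderiv (lshift (sites N) j) g).

Definition partial (R : realType) (n : nat) (i : 'I_n)
    (f : 'rV[R]_n -> R) (z : 'rV[R]_n) : R :=
  'D_(delta_mx 0 i) f z.

(* qdot = dF/dp, pdot = - dF/dq *)
Definition ham_vf (R : realType) (N : nat) (F : phase R N -> R)
    (z : phase R N) : phase R N :=
  row_mx (\row_j partial (rshift (sites N) j) F z)
         (\row_j - partial (lshift (sites N) j) F z).

Definition ham_solution (R : realType) (N : nat) (F : phase R N -> R)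
    (J : set R) (z : R -> phase R N) : Prop :=
  forall t, J t -> is_derive t (1 : R) z (ham_vf F (z t)).

(* Term of order k of the Lie transform: E_k = L_X E_(k-1) / k, E_0 = id. *)
Definition lie_term (R : realType) (N : nat) (X : hpoly R N) (k : nat)
    (f : hpoly R N) : hpoly R N :=
  (k`!%:R)^-1 *: iter k (pbracket X) f.

(* The map z |-> T_X z; the inverse of T_X is T_(-X). *)
Definition lie_map (R : realType) (N : nat) (X : hpoly R N)
    (z : phase R N) : phase R N :=
  \row_i limn (series (fun k => ev (lie_term X k (var R i)) z)).

Definition analytic_at (R : realType) (n : nat) (f : 'rV[R]_n -> R)
    (w : 'rV[R]_n) : Prop :=
  exists (a : nat -> mpoly n R) (r M : R),
    [/\ 0 < r,
        forall k, homog k (a k) /\ polynorm (a k) * r ^+ k <= M &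
        forall z, enorm (z - w) < r ->
          series (fun k => ev (a k) (z - w)) @ \oo --> f z].

Definition symplectic_mx (R : realType) (n : nat) : 'M[R]_(n + n) :=
  block_mx 0 1%:M (- 1%:M) 0.

Definition in_ball (R : realType) (n : nat) (rho : R) (z : 'rV[R]_n) : bool :=
  enorm z <= 2 / 3 * Num.sqrt rho.

Definition Z1 (R : realType) (N : nat) (zeta1 : nat -> hpoly R N) : hpoly R N :=
  cyc (seed_sum zeta1).

Definition P2 (R : realType) (N : nat) (Hs : nat -> hpoly R N)
    (z : phase R N) : R :=
  limn (fun k => \sum_(2 <= s < k) ev (Hs s) z).

Definition H_nf (R : realType) (N : nat) (eps : R) (zeta1 : nat -> hpoly R N)
    (Hs : nat -> hpoly R N) (z : phase R N) : R :=
  ev (HOmega N eps + Z0 N eps + Z1 zeta1) z + P2 Hs z.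

(* Homogeneous components, of degree 2s+2, of H^(1) and of H. *)
Definition H_nf_comp (R : realType) (N : nat) (eps : R)
    (zeta1 Hs : nat -> hpoly R N) (s : nat) : hpoly R N :=
  match s with
  | 0%N => HOmega N eps + Z0 N eps
  | 1%N => Z1 zeta1
  | _ => Hs s
  end.

Definition H_comp (R : realType) (N : nat) (eps : R) (s : nat) : hpoly R N :=
  match s with 0%N => H0 N eps | 1%N => H1 N eps | _ => 0 end.

Record normal_form (R : realType) (N : nat) (Czeta0 Ch1 Ct eps : R)
    (X1 : hpoly R N) (zeta1 Hs : nat -> hpoly R N) : Prop := NormalForm {
  nf_gen : homog 4 X1 /\ cyclically_symmetric X1;
  (* T_X1 H^(1) = H, degree by degree: L_X1 raises the degree by 2. *)
  nf_conj : forall s, \sum_(k < s.+1)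
    lie_term X1 k (H_nf_comp eps zeta1 Hs (s - k)) = H_comp N eps s;
  nf_comm : pbracket (HOmega N eps) (Z0 N eps) = 0 /\
            pbracket (HOmega N eps) (Z1 zeta1) = 0;
  nf_zeta1 : classD 4 Ch1 (2 * eps) zeta1;
  (* |psi_0|^4 = (q_0^2 + p_0^2)^2 / 4 *)
  nf_zeta1_0 : zeta1 0%N = (3 / 8 / 4) *: (Xq R ord0 ^+ 2 + Xp R ord0 ^+ 2) ^+ 2;
  nf_remainder : forall s, (2 <= s)%N ->
    exists2 g : nat -> hpoly R N,
      classD (s.*2.+2) (2 * Ct ^+ s.-1 * Ch1) (Num.sqrt (2 * eps)) g &
      Hs s = cyc (seed_sum g);
  nf_analytic : forall rho (z : phase R N),
    0 < rho < rho_star N Czeta0 Ch1 eps -> in_ball rho z ->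
    cvgn (fun k => \sum_(2 <= s < k) ev (Hs s) z) /\ analytic_at (P2 Hs) z;
  nf_map_analytic : forall rho (z : phase R N) X,
    0 < rho < rho_star N Czeta0 Ch1 eps -> in_ball rho z ->
    X = X1 \/ X = - X1 ->
    forall i, cvgn (series (fun k => ev (lie_term X k (var R i)) z)) /\
              analytic_at (fun w => lie_map X w 0 i) z;
  nf_map_canonical : forall rho (z : phase R N),
    0 < rho < rho_star N Czeta0 Ch1 eps -> in_ball rho z ->
    (jacobian (lie_map X1) z)^T *m symplectic_mx R (sites N)
      *m jacobian (lie_map X1) z = symplectic_mx R (sites N);
  nf_map_inv : forall rho (z : phase R N) X,
    0 < rho < rho_star N Czeta0 Ch1 eps -> in_ball rho z ->
    X = X1 \/ X = - X1 -> in_ball rho (lie_map X z) ->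
    lie_map (- X) (lie_map X z) = z;
  nf_map_close : forall rho (z : phase R N) X,
    0 < rho < rho_star N Czeta0 Ch1 eps -> in_ball rho z ->
    X = X1 \/ X = - X1 ->
    enorm (lie_map X z - z) <= 4 ^+ 4 * Cstar N Czeta0 Ch1 eps * rho `^ (3 / 2)
}.

Definition XN (R : realType) (N : nat) (zeta1 Hs : nat -> hpoly R N) :
    phase R N -> phase R N :=
  ham_vf (fun z : phase R N => ev (Z1 zeta1) z + P2 Hs z).

(* Points of norm of order rho^(1/2) are those of the ball of radius
   (2/3) rho^(1/2), on which the normal form is defined. *)
Definition XN_bound (R : realType) (N : nat) (Czeta0 Ch1 C1 eps : R)
    (zeta1 Hs : nat -> hpoly R N) : Prop :=
  forall rho (z v : phase R N),
    0 < rho < rho_star N Czeta0 Ch1 eps -> in_ball rho z ->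
    enorm ('d (XN zeta1 Hs) z v)
      <= C1 * Ch1 * rho / (1 - (2 * eps) `^ (1 / 4)) ^+ 2 * enorm v.

Definition K_eff (R : realType) (N : nat) (eps : R) (zeta1 : nat -> hpoly R N) :
    hpoly R N :=
  HOmega N eps + cyc (zeta0 N eps 1) + cyc (zeta0 N eps 2) + cyc (zeta1 0%N).

(* Main.v *)
(* The two vector fields differ by the linear part applied to delta = z - z_a,
   by X_N(z) - X_N(z_a), and by a residual evaluated at z_a.  The linear part
   commutes with H_Omega, hence preserves the Euclidean norm; X_N is Lipschitz
   by the mean value theorem and the bound on its differential; the residual
   (couplings at distance at least 3, quartic terms m >= 1, and P^(2)) has size
   rho^(1/2) eps^3 because rho <= eps^2.  Gronwall's inequality for |delta|^2
   then gives |delta| <= C e^(kappa_0 rho |t|) rho^(-1/2) eps^3.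

   The bound on X_N is available on the ball of radius (2/3) rho^(1/2) only,
   which the orbits may leave.  As eps is small in either regime, the Lipschitz
   constant is smaller than kappa_0 by a fixed factor, which leaves room to work
   on a slightly larger ball.  Both orbits stay there: the norm of z is changed
   by P^(2) only, at rate rho^3, and delta is small compared with rho^(1/2). *)
Require Import Defs.
From HB Require Import structures.
From mathcomp Require Import all_boot all_order all_algebra.
From mathcomp Require Import all_classical all_reals all_analysis.
From mathcomp Require Import ring lra zify.
Import Order.TTheory GRing.Theory Num.Theory numFieldNormedType.Exports.
Local Open Scope classical_set_scope.
Local Open Scope ring_scope.

Set Implicit Arguments.
Unset Strict Implicit.
Unset Printing Implicit Defensive.

(** * Polynomials *)

(** The bound on the differential of [XN] concerns ['d], which carries information only where [XN]
    is differentiable, and the mean value theorem needs this along a whole segment. It is drawn from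
    the seeds: the bounds [2 * Ct ^+ s.-1 * Ch1] make the series of the [Hs s] and of its formal
    derivatives converge absolutely where all coordinates are below [R0 = 1 / (4 sqrt Ct)]. This
    radius does not depend on [rho] or [eps], so small [eps] puts every ball in play inside it. As
    [N] is fixed, crude factors of the dimension are allowed everywhere.

    The confinement of the orbits and the Gronwall estimate presuppose each other; the circle is
    broken at a first exit time. No growth estimate is made for [z_a] itself: its norm is controlled
    through those of [z] and [delta].

    Time enters only through [rho * T]. What is required is that [sqrt rho * (rho * T)] stays
    bounded and that [expR (kappa_0 * (rho * T)) * eps^3 / rho] is small. The second requirement is
    what the two regimes of the theorem express, for [rho * T = 1] and for
    [rho * T = alpha / kappa_0 * ln (1 / rho)]. *)

Section PolyNorm.
Variables (R : realType) (n : nat).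
Implicit Types (f g : mpoly n R) (z h : 'rV[R]_n).

Lemma polynorm_ge0 f : 0 <= polynorm f.
Proof. by apply: sumr_ge0. Qed.

Lemma polynorm_supp f (s : seq (multinom n)) :
  uniq s -> {subset msupp f <= s} -> polynorm f = \sum_(m <- s) `|mcoeff m f|.
Proof.
move=> us sub; rewrite /polynorm [RHS](bigID (fun m => m \in msupp f)) /=.
rewrite [X in _ + X]big1_seq ?addr0; last first.
  by move=> m /andP[/memN_msupp_eq0 -> _]; rewrite normr0.
rewrite -[RHS]big_filter; apply: perm_big; apply: uniq_perm => //.
  exact: filter_uniq.
by move=> m; rewrite mem_filter; case: (boolP (m \in msupp f)) => //= /sub.
Qed.

Lemma polynormD f g : polynorm (f + g) <= polynorm f + polynorm g.
Proof.
pose s := undup (msupp f ++ msupp g).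
have us : uniq s by exact: undup_uniq.
have sf : {subset msupp f <= s} by move=> m; rewrite mem_undup mem_cat => ->.
have sg : {subset msupp g <= s}.
  by move=> m; rewrite mem_undup mem_cat orbC => ->.
have sfg : {subset msupp (f + g) <= s}.
  by move=> m /msuppD_le; rewrite mem_undup.
rewrite (polynorm_supp us sf) (polynorm_supp us sg) (polynorm_supp us sfg).
rewrite -big_split /=; apply: ler_sum => m _.
by rewrite mcoeffD ler_normD.
Qed.

Lemma polynorm0 : polynorm (0 : mpoly n R) = 0.
Proof. by rewrite /polynorm msupp0 big_nil. Qed.

Lemma polynorm_sum (I : Type) (r : seq I) (P : pred I) (F : I -> mpoly n R) :
  polynorm (\sum_(i <- r | P i) F i) <= \sum_(i <- r | P i) polynorm (F i).
Proof.
elim/big_rec2: _ => [|i x y _ le]; first by rewrite polynorm0.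
by apply: le_trans (polynormD _ _) _; rewrite lerD2l.
Qed.

Lemma polynormZ c f : polynorm (c *: f) <= `|c| * polynorm f.
Proof.
rewrite (@polynorm_supp (c *: f) (msupp f)) ?msupp_uniq //; last first.
  exact: msuppZ_le.
rewrite /polynorm mulr_sumr; apply: ler_sum => m _.
by rewrite mcoeffZ normrM.
Qed.

Lemma polynormX (m : multinom n) : polynorm (mpolyX R m) = 1.
Proof. by rewrite /polynorm msuppX big_seq1 mcoeffX eqxx normr1. Qed.

Lemma homog0 d : homog d (0 : mpoly n R).
Proof. exact: dhomog0. Qed.

Lemma homogD d f g : homog d f -> homog d g -> homog d (f + g).
Proof. exact: dhomogD. Qed.

Lemma homogZ d c f : homog d f -> homog d (c *: f).
Proof. exact: dhomogZ. Qed.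

Lemma homog_sum d (I : eqType) (r : seq I) (P : pred I) (F : I -> mpoly n R) :
  (forall i, i \in r -> P i -> homog d (F i)) ->
  homog d (\sum_(i <- r | P i) F i).
Proof.
move=> hF; rewrite big_seq_cond; elim/big_rec: _ => [|i x /andP[ir Pi] hx].
  exact: homog0.
by apply: homogD => //; apply: hF.
Qed.

Lemma homog_mdeg d f m : homog d f -> m \in msupp f -> mdeg m = d.
Proof. by move=> hf mf; apply: (dhomog_mf hf). Qed.

Lemma homogX (m : multinom n) : homog (mdeg m) (mpolyX R m).
Proof. by rewrite /homog dhomogX. Qed.

Lemma mderiv_homog d f i : homog d f -> homog d.-1 (mderiv i f).
Proof.
move=> hf; rewrite [X in mderiv i X]mpolyE raddf_sum.
apply: homog_sum => m mf _; rewrite /= mderivZ mderivX.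
apply: homogZ; have [->|mi0] := eqVneq (m i) 0%N.
  by rewrite scale0r homog0.
apply: homogZ; rewrite -(homog_mdeg hf mf).
have le : mpoly.lem (mnm1 i) m by rewrite lep1mP.
rewrite -[in X in homog X _](submK le) mdegD mdeg1 addn1 /=; exact: homogX.
Qed.

Lemma polynorm_mderiv d f i :
  homog d f -> polynorm (mderiv i f) <= d%:R * polynorm f.
Proof.
move=> hf; rewrite [X in mderiv i X]mpolyE raddf_sum.
apply: le_trans (polynorm_sum _ _ _) _.
rewrite [in leRHS]/polynorm mulr_sumr !big_seq; apply: ler_sum => m mf.
rewrite /= mderivZ mderivX; apply: le_trans (polynormZ _ _) _.
rewrite mulrC ler_wpM2r //; apply: le_trans (polynormZ _ _) _.
rewrite polynormX mulr1 normr_nat ler_nat -(homog_mdeg hf mf) mdegE.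
by rewrite (bigD1 i) //= leq_addr.
Qed.

Definition dpoly f z h : R := \sum_i h 0 i * ev (mderiv i f) z.

Lemma evD f g z : ev (f + g) z = ev f z + ev g z.
Proof. exact: mevalD. Qed.
Lemma evZ c f z : ev (c *: f) z = c * ev f z.
Proof. exact: mevalZ. Qed.
Lemma evM f g z : ev (f * g) z = ev f z * ev g z.
Proof. exact: mevalM. Qed.
Lemma ev0 z : ev (0 : mpoly n R) z = 0.
Proof. exact: meval0. Qed.
Lemma ev_sum (I : Type) (r : seq I) (P : pred I) (F : I -> mpoly n R) z :
  ev (\sum_(i <- r | P i) F i) z = \sum_(i <- r | P i) ev (F i) z.
Proof. exact: raddf_sum. Qed.
Lemma ev_var i z : ev (var R i) z = z 0 i.
Proof. exact: mevalXU. Qed.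

Lemma dpolyD f g z h : dpoly (f + g) z h = dpoly f z h + dpoly g z h.
Proof.
rewrite /dpoly -big_split /=; apply: eq_bigr => i _.
by rewrite mderivD evD mulrDr.
Qed.

Lemma dpolyZ c f z h : dpoly (c *: f) z h = c * dpoly f z h.
Proof.
rewrite /dpoly mulr_sumr /=; apply: eq_bigr => i _.
by rewrite mderivZ evZ mulrCA.
Qed.

Lemma dpoly0 z h : dpoly 0 z h = 0.
Proof. by rewrite /dpoly big1 // => i _; rewrite mderiv0 ev0 mulr0. Qed.

Lemma dpoly_varM i g z h :
  dpoly (var R i * g) z h = h 0 i * ev g z + z 0 i * dpoly g z h.
Proof.
rewrite /dpoly mulr_sumr.
under eq_bigr => j _ do rewrite mderivM evD !evM ev_var mulrDr.
rewrite big_split /=; congr (_ + _); last first.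
  by apply: eq_bigr => j _; rewrite mulrCA.
rewrite (bigD1 i) //= big1 ?addr0 => [|j /negPf ji].
  rewrite /var mderivX mnm1E eqxx scale1r.
  have -> : mnm_sub (mnm1 i) (mnm1 i) = mnm0 :> multinom n.
    by apply/mnmP => k; rewrite mnmBE subnn mnm0E.
  by rewrite mpolyX0 /ev meval1 mul1r.
by rewrite /var mderivX mnm1E eq_sym ji scale0r ev0 mul0r mulr0.
Qed.

(** Bounding the coordinates one by one, rather than the Euclidean norm, lets monomials be estimated
    factor by factor. *)
Definition sbound (r : R) z := forall i, `|z 0 i| <= r.

(** Induction on the degree, splitting off one variable. The three bounds go together because the
    Lipschitz step uses the size bound and the Taylor step uses the Lipschitz bound. The truncated
    exponents [d.-1] and [d.-2] are harmless, as their coefficients vanish in low degree. *)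
Lemma mono_bounds (r e : R) z h (m : multinom n) : 0 <= r -> 0 <= e ->
  sbound r z -> sbound r (z + h) -> sbound e h ->
  let d := mdeg m in
  [/\ `|ev (mpolyX R m) z| <= r ^+ d,
      `|ev (mpolyX R m) (z + h) - ev (mpolyX R m) z| <= d%:R * r ^+ d.-1 * e &
      `|ev (mpolyX R m) (z + h) - ev (mpolyX R m) z - dpoly (mpolyX R m) z h|
        <= (d * d.-1)%:R * r ^+ d.-2 * e ^+ 2].
Proof.
move=> r0 e0 bz bzh bh d; rewrite {}/d.
move: {2}(mdeg m) (erefl (mdeg m)) => d; elim: d m => [|d IH] m dm.
  have /eqP -> : m == mnm0 by rewrite -mdeg_eq0 dm.
  rewrite mdeg0 mpolyX0 /ev !meval1 expr0 normr1 subrr.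
  have -> : dpoly 1 z h = 0.
    by rewrite /dpoly big1 // => i _; rewrite -mpolyC1 mderivC ev0 mulr0.
  by rewrite subrr normr0 !mul0r.
have [i mi0] : exists i, m i != 0%N.
  apply/existsP; apply: contraTT isT; rewrite negb_exists => /forallP H.
  have m0 : m = mnm0.
    by apply/mnmP => i; rewrite mnm0E; apply/eqP; move: (H i); rewrite negbK.
  by rewrite m0 mdeg0 in dm.
have le : mpoly.lem (mnm1 i) m by rewrite lep1mP.
set m' := mnm_sub m (mnm1 i).
have dm' : mdeg m' = d.
  by move: dm; rewrite -[in mdeg m](submK le) mdegD mdeg1 addn1 => -[].
have [I1 I2 I3] := IH _ dm'.
have -> : mpolyX R m = var R i * mpolyX R m'.
  by rewrite /var -mpolyXD addmC submK.
rewrite dm !evM !ev_var dpoly_varM; set g := mpolyX R m' in I1 I2 I3 *.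
rewrite dm' in I1 I2 I3; rewrite mxE.
set a := ev g (z + h) in I2 I3 *; set b := ev g z in I1 I2 I3 *.
set l := dpoly g z h in I3 *.
have bzi := bz i; have bhi := bh i; have := bzh i; rewrite mxE => bzhi.
set x := z 0 i in bzi bzhi *; set y := h 0 i in bzhi bhi *.
have I2' : `|y * (a - b)| <= d%:R * r ^+ d.-1 * e ^+ 2.
  rewrite normrM expr2 mulrA mulrC; apply: ler_pM => //.
split=> /=.
- by rewrite normrM exprS; apply: ler_pM.
- have -> : (x + y) * a - x * b = (x + y) * (a - b) + y * b by ring.
  apply: le_trans (ler_normD _ _) _; rewrite !normrM.
  have -> : d.+1%:R * r ^+ d * e = r ^+ d * e *+ d + e * r ^+ d.
    by rewrite -[RHS]/(_ + _) mulrSr -mulr_natl; ring.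
  apply: lerD; last by apply: ler_pM.
  case: d I2 {IH dm dm' I3 I2' I1} => [|d] I2.
    move: I2; rewrite !mul0r mulr0n normr_le0 => /eqP ->.
    by rewrite normr0 mulr0.
  rewrite -mulr_natl exprS.
  have -> : d.+1%:R * (r * r ^+ d * e) = r * (d.+1%:R * r ^+ d * e) by ring.
  by apply: ler_pM.
- have -> : (x + y) * a - x * b - (y * b + x * l)
     = x * (a - b - l) + y * (a - b) by ring.
  apply: le_trans (ler_normD _ _) _.
  have A1 : `|x * (a - b - l)| <= (d * d.-1)%:R * r ^+ d.-1 * e ^+ 2.
    rewrite normrM; case: d I3 {IH dm dm' I2 I2' I1} => [|[|d]] /= I3.
    - by move: I3; rewrite !mul0r normr_le0 => /eqP ->; rewrite normr0 mulr0.
    - move: I3; rewrite muln0 !mul0r normr_le0 => /eqP ->.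
      by rewrite normr0 mulr0.
    - rewrite exprS.
      have -> : (d.+2 * d.+1)%:R * (r * r ^+ d) * e ^+ 2
        = r * ((d.+2 * d.+1)%:R * r ^+ d * e ^+ 2) by ring.
      by apply: ler_pM.
  apply: le_trans (lerD A1 I2') _.
  (* The two contributions add up to [d * d.-1 + d], which is at most [d.+1 * d]. *)
  rewrite -!mulrDl -natrD ler_wpM2r ?exprn_ge0 //.
  rewrite ler_wpM2r ?exprn_ge0 // ler_nat.
  by case: d {IH dm dm' I2 I2' I1 I3 A1} => //= d; nia.
Qed.

Section HomogBounds.
Variables (d : nat) (f : mpoly n R) (r e : R) (z h : 'rV[R]_n).
Hypotheses (hf : homog d f) (r0 : 0 <= r) (bz : sbound r z).

(** A quantity linear in the polynomial need only be bounded on monomials of degree [d]; the three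
    estimates below are instances. *)
Let aux (P : mpoly n R -> R) (B : R) :
  (forall p q, P (p + q) = P p + P q) -> (forall c p, P (c *: p) = c * P p) ->
  P 0 = 0 ->
  (forall m, mdeg m = d -> `|P (mpolyX R m)| <= B) -> `|P f| <= polynorm f * B.
Proof.
move=> PD PZ P0 PX.
have Psum (s : seq (multinom n)) (F : multinom n -> mpoly n R) :
    P (\sum_(m <- s) F m) = \sum_(m <- s) P (F m).
  by elim/big_rec2: _ => [|i x y _ <-].
rewrite [X in P X](mpolyE f) Psum; apply: le_trans (ler_norm_sum _ _ _) _.
rewrite /polynorm mulr_suml !big_seq; apply: ler_sum => m mf.
rewrite PZ normrM ler_wpM2l //; apply: PX; exact: homog_mdeg mf.
Qed.

Lemma homog_bound : `|ev f z| <= polynorm f * r ^+ d.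
Proof.
apply: (@aux (fun f => ev f z)) => [p q|c p||m dm].
- exact: evD.
- exact: evZ.
- exact: ev0.
have bz' : sbound r (z + 0) by rewrite addr0.
have b0 : sbound 0 (0 : 'rV[R]_n) by move=> i; rewrite mxE normr0.
by have [+ _ _] := @mono_bounds r 0 z 0 m r0 (lexx _) bz bz' b0; rewrite dm.
Qed.

Hypotheses (e0 : 0 <= e) (bzh : sbound r (z + h)) (bh : sbound e h).

Lemma homog_lip :
  `|ev f (z + h) - ev f z| <= polynorm f * (d%:R * r ^+ d.-1 * e).
Proof.
apply: (@aux (fun f => ev f (z + h) - ev f z)) => [p q|c p||m dm].
- by rewrite !evD; ring.
- by rewrite !evZ; ring.
- by rewrite !ev0 subr0.
by have [_ + _] := @mono_bounds r e z h m r0 e0 bz bzh bh; rewrite dm.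
Qed.

Lemma homog_taylor :
  `|ev f (z + h) - ev f z - dpoly f z h|
    <= polynorm f * ((d * d.-1)%:R * r ^+ d.-2 * e ^+ 2).
Proof.
apply: (@aux (fun f => ev f (z + h) - ev f z - dpoly f z h)) => [p q|c p||m dm].
- by rewrite !evD dpolyD; ring.
- by rewrite !evZ dpolyZ; ring.
- by rewrite !ev0 dpoly0 !subr0.
by have [_ _ +] := @mono_bounds r e z h m r0 e0 bz bzh bh; rewrite dm.
Qed.
End HomogBounds.

Lemma homog_mderiv_bound d f r z i : homog d f -> 0 <= r -> sbound r z ->
  `|ev (mderiv i f) z| <= d%:R * polynorm f * r ^+ d.-1.
Proof.
move=> hf r0 bz; apply: le_trans (homog_bound (mderiv_homog i hf) r0 bz) _.
by rewrite ler_wpM2r ?exprn_ge0 // polynorm_mderiv.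
Qed.

Lemma sbound_exists z h :
  exists r : R, [/\ 0 <= r, sbound r z, sbound r h & sbound r (z + h)].
Proof.
exists (\sum_i (`|z 0 i| + `|h 0 i|)).
have S i : `|z 0 i| + `|h 0 i| <= \sum_i (`|z 0 i| + `|h 0 i|).
  rewrite (bigD1 i) //= lerDl; apply: sumr_ge0 => j _; exact: addr_ge0.
split=> [|i|i|i].
- by apply: sumr_ge0 => j _; exact: addr_ge0.
- by apply: le_trans (S i); rewrite lerDl.
- by apply: le_trans (S i); rewrite lerDr.
- by rewrite mxE; apply: le_trans (ler_normD _ _) _.
Qed.

(* The Taylor remainder of a linear form vanishes. *)
Lemma homog1_evD f z h : homog 1 f -> ev f (z + h) = ev f z + ev f h.
Proof.
move=> hf.
have key (u v : 'rV[R]_n) : ev f (u + v) = ev f u + dpoly f u v.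
  have [r [r0 bu bv buv]] := sbound_exists u v.
  have := homog_taylor hf r0 bu r0 buv bv.
  by rewrite muln0 !mul0r mulr0 normr_le0 -addrA -opprD subr_eq0 => /eqP.
have dl (u v : 'rV[R]_n) : dpoly f u v = dpoly f 0 v.
  rewrite /dpoly; apply: eq_bigr => i _; congr (_ * _).
  have [r [r0 bu bv buv]] := sbound_exists 0 u.
  have := homog_lip (mderiv_homog i hf) r0 bu r0 buv bv.
  by rewrite !mul0r mulr0 normr_le0 subr_eq0 add0r => /eqP.
have f0 : ev f 0 = 0.
  have := homog_bound hf (lexx 0) (z := 0).
  rewrite expr1 mulr0 normr_le0 => H; apply/eqP/H => i.
  by rewrite mxE normr0.
by rewrite key dl -[in RHS](add0r h) key f0 add0r.
Qed.

End PolyNorm.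

(** * The cyclic shift and the coefficient norm *)

Section Cyclic.
Variables (R : realType) (N : nat).
Implicit Types f g : hpoly R N.

(** Replacing variables by variables sends monomials to monomials; hence the shift keeps homogeneity
    and cannot increase the sum of the absolute values of the coefficients. *)
Lemma substqp_varX (s t : 'I_(sites N) -> 'I_(sites N + sites N))
    (m : multinom (sites N + sites N)) :
  exists2 m', mdeg m' = mdeg m &
    substqp (fun j => var R (s j)) (fun j => var R (t j)) (mpolyX R m)
      = mpolyX R m'.
Proof.
rewrite /substqp comp_mpolyX mdegE.
elim/big_rec2: _ => [|i k p _ [m' <- ->]].
  by exists mnm0; rewrite ?mdeg0 ?mpolyX0.
rewrite tnth_mktuple.
have [l ->] : exists l, match fintype.split i with
    inl j => var R (s j) | inr j => var R (t j) end = var R l.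
  by case: (fintype.split i) => j; [exists (s j)|exists (t j)].
exists (mnm_add (mnm_muln (mnm1 l) (m i)) m').
  by rewrite mdegD mdegMn mdeg1 mul1n.
by rewrite /var mpolyXn -mpolyXD.
Qed.

Lemma ctauX (m : multinom (sites N + sites N)) :
  exists2 m', mdeg m' = mdeg m & ctau (mpolyX R m) = mpolyX R m'.
Proof. exact: substqp_varX. Qed.

Lemma ctauE f : ctau f = \sum_(m <- msupp f) mcoeff m f *: ctau (mpolyX R m).
Proof.
rewrite /ctau /substqp [in LHS](mpolyE f) raddf_sum.
by apply: eq_bigr => m _; rewrite /= comp_mpolyZ.
Qed.

Lemma ctauD f g : ctau (f + g) = ctau f + ctau g.
Proof. exact: comp_mpolyD. Qed.

Lemma ctau_homog d f : homog d f -> homog d (ctau f).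
Proof.
move=> hf; rewrite ctauE; apply: homog_sum => m mf _.
have [m' dm' ->] := ctauX m; apply: homogZ.
by rewrite -(homog_mdeg hf mf) -dm' homogX.
Qed.

Lemma polynorm_ctau f : polynorm (ctau f) <= polynorm f.
Proof.
rewrite ctauE; apply: le_trans (polynorm_sum _ _ _) _.
rewrite [leRHS]/polynorm; apply: ler_sum => m _.
have [m' dm' ->] := ctauX m.
by apply: le_trans (polynormZ _ _) _; rewrite polynormX mulr1.
Qed.

Lemma cycD f g : cyc (f + g) = cyc f + cyc g.
Proof.
rewrite /cyc -big_split /=; apply: eq_bigr => l _.
by elim: (nat_of_ord l) => //= k ->; rewrite ctauD.
Qed.

Lemma cyc_homog d f : homog d f -> homog d (cyc f).
Proof.
move=> hf; apply: homog_sum => l _ _.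
by elim: (nat_of_ord l) => //= k; exact: ctau_homog.
Qed.

Lemma polynorm_cyc f : polynorm (cyc f) <= (sites N)%:R * polynorm f.
Proof.
apply: le_trans (polynorm_sum _ _ _) _.
rewrite mulr_natl -[X in _ *+ X]card_ord -sumr_const; apply: ler_sum => l _.
elim: (nat_of_ord l) => //= k IH.
exact: le_trans (polynorm_ctau _) IH.
Qed.

Lemma polynorm_cyc_sum (a : seq nat) (C : R) (F : nat -> hpoly R N) :
  (forall m, m \in a -> polynorm (F m) <= C) ->
  polynorm (cyc (\sum_(m <- a) F m)) <= (sites N)%:R * ((size a)%:R * C).
Proof.
move=> FC; apply: le_trans (polynorm_cyc _) _; rewrite ler_wpM2l //.
apply: le_trans (polynorm_sum _ _ _) _.
have -> : (size a)%:R * C = \sum_(m <- a) C.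
  by rewrite big_const_seq iter_addr_0 count_predT mulr_natl.
by rewrite !big_seq; apply: ler_sum => m /FC.
Qed.

End Cyclic.

(** * Differentiation of series of polynomials *)

Lemma quadratic_diff (R : realType) (V W : normedModType R) (f : V -> W)
    (df : {linear V -> W}) (x : V) (C r : R) : continuous df -> 0 < r ->
    (forall h, `|h| < r -> `|f (x + h) - f x - df h| <= C * `|h| ^+ 2) ->
  differentiable f x /\ 'd f x = df :> (V -> W).
Proof.
move=> dfc r0 hC.
have E : f \o shift x = cst (f x) + df +o_ 0 id.
  apply/eqaddoP => e e0 /=.
  pose c := `|C| + 1.
  have c0 : 0 < c by rewrite ltr_wpDl.
  near=> h.
  have hr : `|h| < r by near: h; exact: nbhs0_lt.
  have he : `|h| <= e / c by near: h; apply: nbhs0_le; exact: divr_gt0.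
  rewrite [X in `|X| <= _](_ : _ = f (x + h) - f x - df h); last first.
    by rewrite !fctE /= [h + x]addrC opprD addrA.
  apply: (le_trans (hC _ hr)); rewrite expr2 mulrA ler_wpM2r //.
  apply: (@le_trans _ _ (c * `|h|)).
    by rewrite ler_wpM2r // /c (le_trans (ler_norm C)) // lerDl.
  by rewrite mulrC -ler_pdivlMr.
have D := diff_unique dfc E.
split => //; apply/diff_locallyP.
by rewrite D.
Unshelve. all: by end_near. Qed.

Section SupNorm.
Variables (R : realType) (n : nat).
Implicit Types z h : 'rV[R]_n.

Lemma sbound_norm z : sbound `|z| z.
Proof.
move=> i; rewrite [leRHS]/Num.Def.normr/= mx_normrE.
exact: (le_bigmax _ _ (0, i)).
Qed.

Lemma norm_le_sbound z (e : R) : 0 <= e -> sbound e z -> `|z| <= e.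
Proof.
move=> e0 ze; rewrite [leLHS]/Num.Def.normr/= mx_normrE.
by apply/bigmax_leP; split => // -[i j] _; rewrite ord1.
Qed.

Lemma sboundW (r r' : R) z : r <= r' -> sbound r z -> sbound r' z.
Proof. by move=> rr' b i; apply: le_trans rr'. Qed.

Lemma sboundD (r e : R) z h : sbound r z -> sbound e h -> sbound (r + e) (z + h).
Proof. by move=> bz bh i; rewrite mxE (le_trans (ler_normD _ _)) // lerD. Qed.

End SupNorm.

Section Tangent.
Variables (R : realType) (n : nat).
Implicit Types (F : 'rV[R]_n -> R) (z h : 'rV[R]_n) (G : 'I_n -> R).

(** A quadratic remainder with a constant is asked instead of a little-o because such a bound,
    uniform over partial sums, survives the passage to the limit of a series. *)
Definition tangent F z G := exists C r : R, 0 < r /\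
  forall e h, 0 <= e < r -> sbound e h ->
    `|F (z + h) - F z - \sum_i h 0 i * G i| <= C * e ^+ 2.

Lemma tangentD F1 F2 z G1 G2 : tangent F1 z G1 -> tangent F2 z G2 ->
  tangent (fun w => F1 w + F2 w) z (fun i => G1 i + G2 i).
Proof.
move=> [C1 [r1 [r10 H1]]] [C2 [r2 [r20 H2]]].
exists (C1 + C2), (Order.min r1 r2); split; first by rewrite lt_min r10.
move=> e h /andP[e0]; rewrite lt_min => /andP[er1 er2] he.
have -> : \sum_i h 0 i * (G1 i + G2 i) =
    \sum_i h 0 i * G1 i + \sum_i h 0 i * G2 i.
  by rewrite -big_split; apply: eq_bigr => i _; rewrite mulrDr.
rewrite [X in `|X|](_ : _ = (F1 (z + h) - F1 z - \sum_i h 0 i * G1 i) +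
   (F2 (z + h) - F2 z - \sum_i h 0 i * G2 i)); last by ring.
apply: le_trans (ler_normD _ _) _; rewrite mulrDl.
by apply: lerD; [apply: H1|apply: H2] => //; rewrite e0.
Qed.

Lemma tangentN F z G : tangent F z G ->
  tangent (fun w => - F w) z (fun i => - G i).
Proof.
move=> [C [r [r0 H]]]; exists C, r; split => // e h er he.
have -> : \sum_i h 0 i * - G i = - \sum_i h 0 i * G i.
  by rewrite -sumrN; apply: eq_bigr => i _; rewrite mulrN.
by rewrite -!opprD normrN; apply: H.
Qed.

Lemma tangent_near F1 F2 z G (r : R) : 0 < r ->
    (forall h e, 0 <= e < r -> sbound e h -> F1 (z + h) = F2 (z + h)) ->
  tangent F1 z G -> tangent F2 z G.
Proof.
move=> r0 F12 [C [r1 [r10 H]]].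
exists C, (Order.min r r1); split; first by rewrite lt_min r0.
move=> e h /andP[e0]; rewrite lt_min => /andP[er er1] he.
have <- : F1 z = F2 z.
  rewrite -[z]addr0; apply: (F12 _ 0); first by rewrite lexx.
  by move=> i; rewrite mxE normr0.
rewrite -(F12 h e) ?e0 //; apply: H => //; by rewrite e0.
Qed.

Lemma tangent_homog d (f : mpoly n R) z : homog d f ->
  tangent (ev f) z (fun i => ev (mderiv i f) z).
Proof.
move=> hf; pose r := `|z| + 1.
have r0 : 0 <= r by rewrite addr_ge0.
exists (polynorm f * ((d * d.-1)%:R * r ^+ d.-2)), 1; split => //.
move=> e h /andP[e0 e1] bh.
rewrite -!mulrA mulrA -mulrA [X in _ * X]mulrA.
apply: homog_taylor => //.
- by apply: (sboundW _ (sbound_norm z)); rewrite lerDl.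
- by apply: (sboundW _ (sboundD (sbound_norm z) bh)); rewrite lerD2l ltW.
Qed.

Lemma diff_of_tangents m (F : 'rV[R]_n -> 'rV[R]_m) z (G : 'I_m -> 'I_n -> R) :
  (forall k, tangent (fun w => F w 0 k) z (G k)) ->
  differentiable F z /\
  'd F z = (fun h => \row_k \sum_i h 0 i * G k i) :> ('rV[R]_n -> 'rV[R]_m).
Proof.
move=> hG; pose L : 'M[R]_(n, m) := \matrix_(i, k) G k i.
have LE h : h *m L = \row_k \sum_i h 0 i * G k i.
  by apply/rowP => k; rewrite !mxE; apply: eq_bigr => i _; rewrite mxE.
have Lc : continuous (mulmxr L : 'rV[R]_n -> 'rV[R]_m).
  apply: bounded_linear_continuous; apply/bounded_funP => r.
  pose M := \sum_k \sum_i `|G k i|.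
  exists (`|r| * M) => x xr /=.
  have r0 : 0 <= r by apply: le_trans xr.
  apply: norm_le_sbound.
    by rewrite mulr_ge0 // sumr_ge0 // => k _; exact: sumr_ge0.
  move=> k; rewrite LE mxE; apply: le_trans (ler_norm_sum _ _ _) _.
  apply: (@le_trans _ _ (\sum_i r * `|G k i|)).
    apply: ler_sum => i _; rewrite normrM ler_wpM2r //.
    exact: le_trans (sbound_norm x i) xr.
  rewrite -mulr_sumr ger0_norm // ler_wpM2l //.
  rewrite /M (bigD1 k) //= lerDl sumr_ge0 // => j _; exact: sumr_ge0.
have [C [r [r0 H]]] : exists C r, 0 < r /\ forall e h, 0 <= e < r ->
   sbound e h -> forall k, `|F (z + h) 0 k - F z 0 k - \sum_i h 0 i * G k i|
      <= C * e ^+ 2.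
  have [C hC] := choice hG; have [r hr] := choice hC.
  exists (\sum_k `|C k|), (\big[Order.min/1]_k r k); split.
    by apply: lt_bigmin => // k _; have [] := hr k.
  move=> e h /andP[e0 er] bh k; have [_ H] := hr k.
  apply: (@le_trans _ _ (C k * e ^+ 2)).
    apply: H => //; rewrite e0 /=; apply: (lt_le_trans er); exact: bigmin_le_cond.
  rewrite ler_wpM2r ?exprn_ge0 // (bigD1 k) //= (le_trans (ler_norm _)) //.
  by rewrite lerDl sumr_ge0.
have [] := @quadratic_diff R _ _ F (mulmxr L) z `|C| r Lc r0 _.
  move=> h hr; apply: norm_le_sbound.
    by rewrite mulr_ge0.
  move=> k; rewrite /= LE !mxE.
  apply: le_trans (H `|h| h _ (sbound_norm h) k) _; first by rewrite hr andbT.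
  by rewrite ler_wpM2r ?exprn_ge0 // ler_norm.
by move=> D ->; split=> //; apply/funext => h /=; rewrite LE.
Qed.

Lemma tangent_partial F z G i : tangent F z G -> partial i F z = G i.
Proof.
move=> hG.
(* The scalar function is seen as a vector with one coordinate. *)
have [] := @diff_of_tangents 1 (fun w => \row_(_ < 1) F w) z (fun _ => G) _.
  move=> k; apply: tangent_near hG; first exact: ltr01.
  by move=> h e _ _; rewrite mxE.
move=> D DE.
have dd := @diff_derivable _ _ _ _ _ (delta_mx 0 i) D.
have := @deriveE _ _ _ _ _ (delta_mx 0 i) D; rewrite DE (derive_mx dd).
move=> /rowP /(_ 0); rewrite !mxE.
under eq_fun do rewrite mxE.
rewrite (bigD1 i) //= mxE !eqxx mul1r big1 ?addr0 // => j ji.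
by rewrite mxE (negPf ji) andbF mul0r.
Qed.

End Tangent.

Section SeriesOfPolynomials.
Variable R : realType.

(** Comparison test: the partial sums of [|u s|] increase and stay below [B], and the bound passes
    to the limit. *)
Lemma is_cvg_sum2 (u w : R^nat) (B : R) :
    (forall s, (2 <= s)%N -> `|u s| <= w s) ->
    (forall k, \sum_(2 <= s < k) w s <= B) ->
  cvgn (fun k => \sum_(2 <= s < k) u s) /\
  `|limn (fun k => \sum_(2 <= s < k) u s)| <= B.
Proof.
move=> uw wB.
have nB k : `|\sum_(2 <= s < k) u s| <= B.
  apply: le_trans (ler_norm_sum _ _ _) _; apply: le_trans (wB k).
  rewrite big_nat [leRHS]big_nat; apply: ler_sum => s /andP[s2 _]; exact: uw.
have cu : cvgn (fun k => \sum_(2 <= s < k) u s).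
  rewrite is_cvg_series_restrict; apply: normed_cvg.
  rewrite -(is_cvg_series_restrict 2).
  apply: nondecreasing_is_cvgn.
    apply/nondecreasing_seqP => k.
    case: (leqP 2 k) => k2 /=; first by rewrite big_nat_recr //= lerDl.
    by rewrite [leLHS]big_geq ?sumr_ge0 // ltnW.
  exists B => _ [k _ <-]; apply: le_trans (wB k); rewrite /=.
  rewrite big_nat [leRHS]big_nat; apply: ler_sum => s /andP[s2 _]; exact: uw.
split => //.
rewrite -(cvg_lim _ (cvg_norm cu)) //.
by apply: limr_le; [exact: is_cvg_norm|near=> k; exact: nB].
Unshelve. all: by end_near. Qed.

Variable n : nat.
Variables (a : nat -> mpoly n R) (d : nat -> nat) (R0 B : R).
Hypothesis R0_gt0 : 0 < R0.
Hypothesis ha : forall s, (2 <= s)%N -> (0 < d s)%N /\ homog (d s) (a s).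
(** The weight [(d s) ^+ 2] pays for the factor [d * d.-1] of a Taylor remainder, and a fortiori for
    the factor [d] of a first derivative. *)
Hypothesis hB : forall k,
  \sum_(2 <= s < k) polynorm (a s) * (d s)%:R ^+ 2 * R0 ^+ d s <= B.

Definition sum_ev (b : nat -> mpoly n R) (z : 'rV[R]_n) : R :=
  limn (fun k => \sum_(2 <= s < k) ev (b s) z).

Lemma is_cvg_sum_ev z : sbound R0 z ->
  cvgn (fun k => \sum_(2 <= s < k) ev (a s) z).
Proof.
move=> bz.
suff /is_cvg_sum2/(_ hB)[] : forall s, (2 <= s)%N -> `|ev (a s) z| <=
  polynorm (a s) * (d s)%:R ^+ 2 * R0 ^+ d s by [].
move=> s /ha [d0 hs].
apply: le_trans (homog_bound hs (ltW R0_gt0) bz) _.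
rewrite ler_wpM2r ?exprn_ge0 ?(ltW R0_gt0) // ler_peMr ?polynorm_ge0 //.
by rewrite -natrX ler1n expn_gt0 d0.
Qed.

(** Here [q] is a guaranteed order of vanishing at the origin: when [q < d], the powers satisfy
    [(r / R0)^(d-1) <= (r / R0)^q]. The value [q = 0] yields convergence, and [q = 5] will serve for
    the remainder. *)
Lemma sum_ev_mderiv i (r : R) z : 0 <= r <= R0 -> sbound r z ->
  cvgn (fun k => \sum_(2 <= s < k) ev (mderiv i (a s)) z) /\
  (forall q : nat, (forall s, (2 <= s)%N -> (q < d s)%N) ->
     `|sum_ev (fun s => mderiv i (a s)) z| <= B / R0 ^+ q.+1 * r ^+ q).
Proof.
move=> /andP[r0 rR] bz.
have key q : (forall s, (2 <= s)%N -> (q < d s)%N) -> forall s, (2 <= s)%N ->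
    `|ev (mderiv i (a s)) z| <=
    r ^+ q / R0 ^+ q.+1 * (polynorm (a s) * (d s)%:R ^+ 2 * R0 ^+ d s).
  move=> hq s s2; have [d0 hs] := ha s2.
  apply: le_trans (homog_mderiv_bound i hs r0 bz) _.
  have qd : (q <= (d s).-1)%N by rewrite -ltnS prednK // hq.
  rewrite -[in leLHS](subnKC qd) exprD.
  have -> : R0 ^+ d s = R0 ^+ q.+1 * R0 ^+ ((d s).-1 - q).
    by rewrite -exprD addSn subnKC // prednK.
  rewrite [leRHS](_ : _ = (d s)%:R * polynorm (a s) *
     (r ^+ q * R0 ^+ ((d s).-1 - q)) * (d s)%:R); last first.
    have X0 : R0 ^+ q.+1 != 0 by rewrite expf_neq0 ?gt_eqF.
    by move: X0; move: (R0 ^+ q.+1) => X X0; field.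
  rewrite -[leLHS]mulr1 ler_pM //.
  - by rewrite !mulr_ge0 ?exprn_ge0 ?polynorm_ge0.
  - rewrite ler_wpM2l ?mulr_ge0 ?polynorm_ge0 //.
    by rewrite ler_wpM2l ?exprn_ge0 // lerXn2r // nnegrE (ltW R0_gt0).
  - by rewrite ler1n.
have bnd q k : \sum_(2 <= s < k) r ^+ q / R0 ^+ q.+1 *
    (polynorm (a s) * (d s)%:R ^+ 2 * R0 ^+ d s) <= B / R0 ^+ q.+1 * r ^+ q.
  rewrite -mulr_sumr [leRHS](_ : _ = r ^+ q / R0 ^+ q.+1 * B); last by ring.
  by rewrite ler_wpM2l ?divr_ge0 ?exprn_ge0 // ltW.
split=> [|q hq].
  have [] // := is_cvg_sum2 (key 0%N _) (bnd 0%N) => s s2.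
  by have [] := ha s2.
by have [_] := is_cvg_sum2 (key q hq) (bnd q).
Qed.

Lemma tangent_sum_ev (r : R) z : 0 <= r < R0 -> sbound r z ->
  tangent (sum_ev a) z (fun i => sum_ev (fun s => mderiv i (a s)) z).
Proof.
move=> /andP[r0 rR] bz.
exists (B / R0 ^+ 2), (R0 - r); split; first by rewrite subr_gt0.
move=> e h /andP[e0 er] bh.
have bz0 : sbound R0 z by apply: sboundW bz; exact: ltW.
have bzh : sbound R0 (z + h).
  by apply: (sboundW _ (sboundD bz bh)); rewrite -lerBrDl ltW.
(* Taylor remainders of the partial sums; their bound does not depend on [k], so it passes to the
   limit. *)
pose T k := \sum_(2 <= s < k) ev (a s) (z + h) - \sum_(2 <= s < k) ev (a s) z -
  \sum_i h 0 i * \sum_(2 <= s < k) ev (mderiv i (a s)) z.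
have cT : T k @[k --> \oo] --> sum_ev a (z + h) - sum_ev a z -
    \sum_i h 0 i * sum_ev (fun s => mderiv i (a s)) z.
  apply: cvgB.
    by apply: cvgB; exact: is_cvg_sum_ev.
  apply: cvg_big => [|i _]; first exact: add_continuous.
  apply: cvgM; first exact: cvg_cst.
  by have [] := @sum_ev_mderiv i r z _ bz; rewrite ?r0 ?(ltW rR).
have bT k : `|T k| <= B / R0 ^+ 2 * e ^+ 2.
  have -> : T k = \sum_(2 <= s < k)
      (ev (a s) (z + h) - ev (a s) z - dpoly (a s) z h).
    rewrite /T !sumrB; congr (_ - _); rewrite /dpoly exchange_big /=.
    by apply: eq_bigr => i _; rewrite mulr_sumr.
  apply: le_trans (ler_norm_sum _ _ _) _.
  rewrite mulrAC; apply: (@le_trans _ _ (\sum_(2 <= s < k)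
    (polynorm (a s) * (d s)%:R ^+ 2 * R0 ^+ d s) * (e ^+ 2 / R0 ^+ 2)));
    last first.
    rewrite -mulr_suml -mulrA ler_wpM2r // ?divr_ge0 ?exprn_ge0 //.
    exact: ltW.
  rewrite big_nat [leRHS]big_nat; apply: ler_sum => s /andP[s2 _].
  have [d0 hs] := ha s2.
  apply: le_trans (homog_taylor hs (ltW R0_gt0) bz0 e0 bzh bh) _.
  rewrite -!mulrA ler_wpM2l ?polynorm_ge0 //.
  (* Degree one is treated apart: there [d.-2] is truncated, but the factor [d * d.-1] is zero. *)
  case: (d s) d0 => [//|[|m]] _.
    rewrite muln0 mul0r !mulr_ge0 ?exprn_ge0 ?invr_ge0 ?exprn_ge0 //; exact: ltW.
  rewrite [leRHS](_ : _ = m.+2%:R ^+ 2 * (R0 ^+ m * e ^+ 2)); last first.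
    by rewrite !exprS; field; rewrite gt_eqF.
  rewrite ler_wpM2r ?mulr_ge0 ?exprn_ge0 //; first exact: ltW.
  by rewrite -natrX ler_nat expnS expn1 leq_mul.
rewrite -(cvg_lim _ (cvg_norm cT)) //.
apply: limr_le; first by apply: is_cvg_norm; apply: cvgP cT.
by near=> k; exact: bT.
Unshelve. all: by end_near. Qed.

End SeriesOfPolynomials.

(** * Differential inequalities *)

Section Gronwall.
Variable R : realType.
Implicit Types (u du U V W : R -> R).

(** The derivative of [u s * expR (- k * s)] is nonpositive. The inequality is asked on the
    half-open interval because the trapping argument knows nothing yet at the first exit time
    itself. *)
Lemma gronwall u du (k t : R) : 0 <= t ->
    (forall s, 0 <= s <= t -> is_derive s (1 : R) u (du s)) ->
    (forall s, 0 <= s < t -> du s <= k * u s) ->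
  u t <= u 0 * expR (k * t).
Proof.
move=> t0 hd hle.
pose g s := u s * expR (- k * s).
pose dg s := (du s - k * u s) * expR (- k * s).
have hg s : 0 <= s <= t -> is_derive s (1 : R) g (dg s).
  move=> st; have := hd _ st => hus.
  have he : is_derive s (1 : R) (fun r => expR (- k * r)) (- k * expR (- k * s)).
    have hl : is_derive s (1 : R) (fun r => - k * r) (- k).
      have := @is_deriveZ _ _ _ id (- k) s 1 1 (is_derive_id _ _).
      by move=> h; apply: (is_derive_eq h); rewrite /GRing.scale /= mulr1.
    have := @is_derive1_comp _ expR (fun r => - k * r) s _ _ (is_derive_expR _) hl.
    by move=> h; apply: (is_derive_eq h); rewrite mulrC.
  apply: (is_derive_eq (is_deriveM hus he)).
  by rewrite /dg /GRing.scale /=; ring.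
move: t0; rewrite le_eqVlt => /predU1P[<-|t0].
  by rewrite mulr0 expR0 mulr1.
have [||c /[!in_itv]/= /andP[c0 ct]] := @MVT R g dg 0 t t0.
- by move=> x /[!in_itv]/= /andP[/ltW x0 /ltW xt]; apply: hg; rewrite x0.
- apply: continuous_in_subspaceT => x; rewrite inE/= in_itv/= => xt.
  have := hg _ xt => hx; apply: differentiable_continuous.
  exact/derivable1_diffP.
rewrite subr0 => E.
have : g t <= g 0.
  rewrite -subr_le0 E mulr_le0_ge0 ?(ltW t0) // mulr_le0_ge0 ?expR_ge0 //.
  by rewrite subr_le0 hle // (ltW c0).
rewrite /g mulr0 expR0 mulr1 mulNr expRN.
by rewrite ler_pdivrMr ?expR_gt0.
Qed.

Lemma le_of_derive u du (A t : R) : 0 <= t ->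
    (forall s, 0 <= s <= t -> is_derive s (1 : R) u (du s)) ->
    (forall s, 0 <= s < t -> du s <= A) ->
  u t <= u 0 + A * t.
Proof.
move=> t0 hd hle.
move: t0; rewrite le_eqVlt => /predU1P[<-|t0]; first by rewrite mulr0 addr0.
have [||c /[!in_itv]/= /andP[c0 ct]] := @MVT R u du 0 t t0.
- by move=> x /[!in_itv]/= /andP[/ltW x0 /ltW xt]; apply: hd; rewrite x0.
- apply: continuous_in_subspaceT => x; rewrite inE/= in_itv/= => xt.
  have := hd _ xt => hx; apply: differentiable_continuous.
  exact/derivable1_diffP.
rewrite subr0 => /eqP; rewrite subr_eq addrC => /eqP ->.
by rewrite lerD2l ler_wpM2r ?(ltW t0) // hle // (ltW c0).
Qed.

(* The differential inequalities are only available while U and V stay below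
   M, and together with hgood they keep U and V strictly below M. *)
Lemma gronwall_trapped U V W (dU dV dW : R -> R) (t1 M A k B : R) :
    0 <= t1 -> 0 < k -> 0 <= B -> 0 <= A ->
    (forall s, 0 <= s <= t1 -> [/\ is_derive s (1 : R) U (dU s),
      is_derive s (1 : R) V (dV s) & is_derive s (1 : R) W (dW s)]) ->
    (forall s, 0 <= s <= t1 -> U s < M -> V s < M ->
      dU s <= A /\ dW s <= k * W s + B) ->
    0 <= W 0 ->
    (forall s, 0 <= s <= t1 -> U s <= U 0 + A * t1 ->
      W s <= (W 0 + B / k) * expR (k * t1) -> U s < M /\ V s < M) ->
  W t1 <= (W 0 + B / k) * expR (k * t1).
Proof.
move=> t10 k0 B0 A0 hd hdle W0 hgood.
pose good s := U s < M /\ V s < M.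
have est s : 0 <= s <= t1 -> (forall r, 0 <= r < s -> good r) ->
    U s <= U 0 + A * t1 /\ W s <= (W 0 + B / k) * expR (k * t1).
  move=> /andP[s0 st1] hr; split.
    apply: (@le_trans _ _ (U 0 + A * s)); last by rewrite lerD2l ler_wpM2l.
    apply: (@le_of_derive U dU) => // r /andP[r0 rs].
      by have [] := hd r _; rewrite ?r0 ?(le_trans rs).
    have [|Ur Vr] := hr r; first by rewrite r0 rs.
    by have [|] := hdle r _ Ur Vr; rewrite ?r0 ?(le_trans (ltW rs)).
  apply: (@le_trans _ _ ((W 0 + B / k) * expR (k * s))); last first.
    rewrite ler_wpM2l ?addr_ge0 ?divr_ge0 ?(ltW k0) // ler_expR.
    by rewrite ler_wpM2l ?(ltW k0).
  (* The shift by [B / k] turns the affine inequality into a linear one. *)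
  pose W1 r := W r + B / k.
  apply: (@le_trans _ _ (W1 s)); first by rewrite lerDl divr_ge0 // ltW.
  apply: (@gronwall W1 dW) => // r /andP[r0 rs].
    have [|_ _ hW] := hd r; first by rewrite r0 (le_trans rs).
    by apply: is_derive_eq; rewrite addr0.
  have [|Ur Vr] := hr r; first by rewrite r0 rs.
  have [|_] := hdle r _ Ur Vr; first by rewrite r0 (le_trans (ltW rs)).
  by rewrite /W1 mulrDr [k * (B / k)]mulrC divfK ?gt_eqF.
have cont (f df : R -> R) s : is_derive s (1 : R) f (df s) -> f s < M ->
    \forall r \near s, f r < M.
  move=> hf fM; have fc : {for s, continuous f}.
    by apply: differentiable_continuous; exact/derivable1_diffP.
  by move/cvgr_lt: fc; exact.
have allgood s : 0 <= s <= t1 -> good s.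
  move=> st; apply: contrapT => ng.
  (* The infimum [s0] of the bad times is itself good, since the estimates hold before it and reach
     it; by continuity a neighbourhood is then good, which contradicts the infimum. *)
  pose E := [set r : R | 0 <= r <= t1 /\ ~ good r].
  have E0 : E !=set0 by exists s.
  have lE : lbound E 0 by move=> r [/andP[]].
  have hE : has_inf E by split => //; exists 0.
  set s0 := inf E.
  have s00 : 0 <= s0 by apply: lb_le_inf.
  have s0s : s0 <= s by apply: ge_inf; [exists 0|].
  have s0t : 0 <= s0 <= t1.
    by rewrite s00 (le_trans s0s) //; case/andP: st.
  have below r : 0 <= r < s0 -> good r.
    move=> /andP[r0 rs]; apply: contrapT => nr.
    have : s0 <= r.
      apply: ge_inf; first by exists 0.
      by split => //; rewrite r0 /= (le_trans (ltW rs)) //; case/andP: s0t.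
    by rewrite leNgt rs.
  have [e1 e2] := est _ s0t below.
  have [Us Vs] := hgood _ s0t e1 e2.
  have [dU0 dV0 _] := hd _ s0t.
  have : \forall r \near s0, good r.
    by near=> r; split; near: r; [exact: cont dU0 Us|exact: cont dV0 Vs].
  move=> /nbhs_ballP[e /= e0 he].
  have : s0 + e <= s0.
    apply: lb_le_inf => // r Er; have s0r : s0 <= r by apply: ge_inf; [exists 0|].
    case: Er => _ nr; rewrite leNgt; apply/negP => re.
    apply: nr; apply: he; rewrite /ball /= distrC ger0_norm.
      by rewrite ltrBlDl.
    by rewrite subr_ge0.
  by rewrite gerDl leNgt e0.
have t1t : 0 <= t1 <= t1 by rewrite t10 lexx.
have [r /andP[r0 rt]|_ //] := est t1 t1t.
by apply: allgood; rewrite r0 ltW.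
Unshelve. all: by end_near.
Qed.

End Gronwall.

(** * Hamiltonian vector fields *)

Section Square.
Variable R : realType.

Definition dot n (u v : 'rV[R]_n) : R := \sum_i u 0 i * v 0 i.

Section Dot.
Variable n : nat.
Implicit Types u v w : 'rV[R]_n.

Lemma dotDr u v w : dot u (v + w) = dot u v + dot u w.
Proof. by rewrite /dot -big_split; apply: eq_bigr => i _; rewrite mxE mulrDr. Qed.

Lemma dotNr u v : dot u (- v) = - dot u v.
Proof. by rewrite /dot -sumrN; apply: eq_bigr => i _; rewrite mxE mulrN. Qed.

Lemma dot_ge0 u : 0 <= dot u u.
Proof. by apply: sumr_ge0 => i _; rewrite -expr2 sqr_ge0. Qed.

Lemma enorm_sqr u : enorm u ^+ 2 = dot u u.
Proof.
rewrite /enorm sqr_sqrtr; first by apply: eq_bigr => i _; rewrite expr2.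
by apply: sumr_ge0 => i _; rewrite sqr_ge0.
Qed.

Lemma enorm_ge0 u : 0 <= enorm u. Proof. exact: sqrtr_ge0. Qed.

Lemma enorm_le u (r : R) : 0 <= r -> (enorm u <= r) = (dot u u <= r ^+ 2).
Proof.
by move=> r0; rewrite -enorm_sqr ler_pXn2r // nnegrE enorm_ge0.
Qed.

Lemma dot_young u v (c : R) : 0 < c -> 2 * dot u v <= c * dot u u + dot v v / c.
Proof.
move=> c0; rewrite /dot mulr_suml !mulr_sumr -big_split /=.
apply: ler_sum => i _; set x := u 0 i; set y := v 0 i.
rewrite -subr_ge0 [X in 0 <= X](_ : _ = (c * x - y) ^+ 2 / c).
  by rewrite divr_ge0 ?sqr_ge0 // ltW.
by field; rewrite gt_eqF.
Qed.

Lemma dot_bound u v (r b : R) : sbound r u -> sbound b v -> 0 <= r ->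
  `|dot u v| <= n%:R * (r * b).
Proof.
move=> bu bv r0; apply: le_trans (ler_norm_sum _ _ _) _.
rewrite mulr_natl -[X in _ *+ X]card_ord -sumr_const.
by apply: ler_sum => i _; rewrite normrM ler_pM.
Qed.

Lemma sbound_dot u (r : R) : 0 <= r -> dot u u <= r ^+ 2 -> sbound r u.
Proof.
move=> r0 H i; rewrite -(@ler_pXn2r _ 2) ?nnegrE // real_normK ?num_real //.
apply: le_trans H; rewrite /dot (bigD1 i) //= expr2 lerDl.
by apply: sumr_ge0 => j _; rewrite -expr2 sqr_ge0.
Qed.

Lemma dot_subr_le u v (s : R) : 0 < s ->
  dot (u - v) (u - v) <= (1 + s) * dot u u + (1 + s^-1) * dot v v.
Proof.
move=> s0; rewrite /dot !mulr_sumr -big_split /=; apply: ler_sum => i _.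
rewrite !mxE; set x := u 0 i; set y := v 0 i.
rewrite -subr_ge0 [X in 0 <= X](_ : _ = (s * x + y) ^+ 2 / s).
  by rewrite divr_ge0 ?sqr_ge0 // ltW.
by field; rewrite gt_eqF.
Qed.

Lemma dot_convex u v (s : R) : 0 <= s <= 1 ->
  dot (u + s *: (v - u)) (u + s *: (v - u)) <= (1 - s) * dot u u + s * dot v v.
Proof.
move=> /andP[s0 s1]; rewrite /dot !mulr_sumr -big_split /=; apply: ler_sum => i _.
rewrite !mxE; set x := u 0 i; set y := v 0 i.
rewrite -subr_ge0 [X in 0 <= X](_ : _ = s * (1 - s) * (y - x) ^+ 2).
  by rewrite mulr_ge0 ?sqr_ge0 // mulr_ge0 // subr_ge0.
by ring.
Qed.

Lemma is_derive_coord (z : R -> 'rV[R]_n) t v i : is_derive t (1 : R) z v ->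
  is_derive t (1 : R) (fun s => z s 0 i) (v 0 i).
Proof.
move=> hz; have D := @ex_derive _ _ _ _ _ _ _ hz.
have Di := (derivable_mxP z t 1).1 D 0 i.
apply: DeriveDef => //.
by have := @derive_val _ _ _ _ _ _ _ hz; rewrite (derive_mx D) => <-; rewrite mxE.
Qed.

Lemma is_derive_dot (z w : R -> 'rV[R]_n) t v u :
  is_derive t (1 : R) z v -> is_derive t (1 : R) w u ->
  is_derive t (1 : R) (fun s => dot (z s) (w s)) (dot v (w t) + dot (z t) u).
Proof.
move=> hz hw.
have H i : is_derive t (1 : R) (fun s => z s 0 i * w s 0 i)
    (v 0 i * w t 0 i + z t 0 i * u 0 i).
  apply: (is_derive_eq (is_deriveM (is_derive_coord i hz) (is_derive_coord i hw))).
  by rewrite /GRing.scale /=; ring.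
have := @is_derive_sum _ _ _ n (fun i s => z s 0 i * w s 0 i) t 1 _ H.
rewrite (_ : \sum_(i < n) _ = fun s => dot (z s) (w s)); last first.
  by apply/funext => s; rewrite fct_sumE.
move=> h; apply: (is_derive_eq h).
by rewrite /dot -big_split.
Qed.

Lemma is_derive_sqr (z : R -> 'rV[R]_n) t v : is_derive t (1 : R) z v ->
  is_derive t (1 : R) (fun s => dot (z s) (z s)) (2 * dot (z t) v).
Proof.
move=> hz; apply: (is_derive_eq (is_derive_dot hz hz)).
rewrite mulr_natl mulr2n; congr (_ + _).
by apply: eq_bigr => i _; rewrite mulrC.
Qed.

End Dot.

(** Only the component of [X z - X w] along [h = z - w] matters, so the scalar mean value theorem
    for [dot h (X (w + s *: h))] is enough. Young's inequality with weight [k] takes the place of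
    Cauchy-Schwarz. *)
Lemma dot_mvt n (X : 'rV[R]_n -> 'rV[R]_n) (w z : 'rV[R]_n) (k : R) : 0 < k ->
    (forall s, 0 <= s <= 1 -> let y := w + s *: (z - w) in
      differentiable X y /\
      dot ('d X y (z - w)) ('d X y (z - w)) <= k ^+ 2 * dot (z - w) (z - w)) ->
  `|dot (z - w) (X z - X w)| <= k * dot (z - w) (z - w).
Proof.
move=> k0 hX; set h := z - w in hX *.
pose y s : 'rV[R]_n := w + s *: h.
pose f s := dot h (X (y s)).
pose df s := dot h ('d X (y s) h).
have hd (s : R) : 0 <= s <= 1 -> is_derive s (1 : R) f (df s).
  move=> /hX[D _].
  have hy : is_diff s y ( *:%R ^~ h).
    have := is_diffD (is_diff_cst w s) (is_diff_scalel s h).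
    by rewrite add0r.
  have dy := @ex_diff _ _ _ _ _ _ _ hy.
  have hXy : is_derive s (1 : R) (X \o y) ('d X (y s) h).
    have DX := differentiable_comp dy D.
    apply: DeriveDef; first exact: diff_derivable.
    rewrite deriveE // diff_comp //= (@diff_val _ _ _ _ _ _ _ hy).
    by rewrite scale1r.
  have := is_derive_dot (is_derive_cst h s 1) hXy.
  move=> H; apply: (is_derive_eq H).
  by rewrite /dot big1 ?add0r // => i _; rewrite mxE mul0r.
have [||c /[!in_itv]/= /andP[c0 c1]] := @MVT R f df 0 1 ltr01.
- by move=> x /[!in_itv]/= /andP[/ltW x0 /ltW x1]; apply: hd; rewrite x0.
- apply: continuous_in_subspaceT => x; rewrite inE/= in_itv/= => xt.
  have := hd _ xt => hx; apply: differentiable_continuous.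
  exact/derivable1_diffP.
rewrite subr0 mulr1 /f /y scale1r scale0r addr0 {2}/h [w + _]addrC subrK.
rewrite dotDr dotNr => ->; rewrite -/h /df.
have [] := hX c; first by rewrite (ltW c0) ltW.
move=> _; rewrite -/(y c); set v := 'd X (y c) h => hv.
have := dot_young h v k0; have := dot_young h (- v) k0.
rewrite dotNr (_ : dot (- v) (- v) = dot v v); last first.
  by apply: eq_bigr => i _; rewrite !mxE mulrNN.
rewrite ler_norml; have : dot v v / k <= k * dot h h.
  by rewrite ler_pdivrMr // mulrAC -expr2.
by move=> *; apply/andP; split; lra.
Qed.

End Square.

Section Hamiltonian.
Variables (R : realType) (N : nat).
Implicit Types (z w : phase R N) (f g : hpoly R N).
Local Notation D := (sites N + sites N)%N.

(** The symplectic matrix applied to a gradient [G], whether [G] comes from formal derivatives or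
    from limits of series. *)
Definition symp (G : 'I_D -> R) : phase R N :=
  row_mx (\row_j G (rshift (sites N) j)) (\row_j - G (lshift (sites N) j)).

Definition poly_vf f z : phase R N := symp (fun i => ev (mderiv i f) z).

Lemma ham_vf_tangent F z G : tangent F z G -> ham_vf F z = symp G.
Proof.
move=> hG; rewrite /ham_vf /symp; congr row_mx; apply/rowP => j;
by rewrite !mxE (tangent_partial _ hG).
Qed.

Lemma symp_coord k :
  exists l (b : bool), forall G, symp G 0 k = (-1) ^+ b * G l.
Proof.
rewrite /symp; case: (split_ordP k) => j ->.
  by exists (rshift _ j), false => G; rewrite row_mxEl mxE mul1r.
by exists (lshift _ j), true => G; rewrite row_mxEr mxE mulN1r.
Qed.

Lemma sympD G1 G2 : symp (fun i => G1 i + G2 i) = symp G1 + symp G2.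
Proof.
apply/rowP => k; rewrite [RHS]mxE.
have [l [b H]] := symp_coord k.
by rewrite !H mulrDr.
Qed.

Lemma symp_bound (G : 'I_D -> R) (B : R) :
  (forall i, `|G i| <= B) -> sbound B (symp G).
Proof.
move=> HG k; have [l [b ->]] := symp_coord k.
by rewrite normrM normrX normrN1 expr1n mul1r.
Qed.

Lemma poly_vfD f g z : poly_vf (f + g) z = poly_vf f z + poly_vf g z.
Proof.
rewrite /poly_vf -sympD; congr symp; apply/funext => i.
by rewrite mderivD evD.
Qed.

Lemma poly_vf_linear f z w : homog 2 f ->
  poly_vf f (z + w) = poly_vf f z + poly_vf f w.
Proof.
move=> hf; rewrite /poly_vf -sympD; congr symp; apply/funext => i.
by apply: homog1_evD; exact: (mderiv_homog i hf).
Qed.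

Lemma poly_vf_bound d f z (r : R) : homog d f -> 0 <= r -> sbound r z ->
  sbound (d%:R * polynorm f * r ^+ d.-1) (poly_vf f z).
Proof. by move=> hf r0 bz; apply: symp_bound => i; apply: homog_mderiv_bound. Qed.

Lemma dot_symp z G : dot z (symp G) = \sum_(j < sites N)
  (z 0 (lshift _ j) * G (rshift _ j) - z 0 (rshift _ j) * G (lshift _ j)).
Proof.
rewrite /dot big_split_ord /= -big_split /=; apply: eq_bigr => j _.
by rewrite /symp row_mxEl row_mxEr !mxE mulrN.
Qed.

Lemma mderiv_var i k : mderiv i (var R k : hpoly R N) = ((k == i)%:R)%:A.
Proof.
rewrite /var mderivX mnm1E; have [->|] := eqVneq; last by rewrite !scale0r.
have -> : mnm_sub (mnm1 i) (mnm1 i) = mnm0 :> multinom D.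
  by apply/mnmP => l; rewrite mnmBE subnn mnm0E.
by rewrite mpolyX0.
Qed.

Lemma mderiv_HOmega eps i :
  mderiv i (HOmega N eps) = Omega N eps *: var R i :> hpoly R N.
Proof.
rewrite /HOmega mderivZ (big_morph _ (mderivD i) (mderiv0 R i)).
have E : \sum_(j < sites N) mderiv i (Xq R j ^+ 2 + Xp R j ^+ 2) =
    \sum_(k < D) mderiv i (var R k ^+ 2).
  rewrite [RHS]big_split_ord /= -big_split /=; apply: eq_bigr => j _.
  by rewrite mderivD.
rewrite [X in _ *: X](_ : _ = 2 *: var R i).
  by rewrite scalerA divfK.
rewrite E (bigD1 i) //= big1 ?addr0 => [|k ki]; rewrite expr2 mderivM mderiv_var.
  by rewrite eqxx scale1r mul1r mulr1 -mulr2n -scaler_nat.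
by rewrite (negPf ki) scale0r mul0r mulr0 addr0.
Qed.

(** The gradient of [HOmega] is [Omega] times the position, so the bracket measures the radial
    component of the field of [f]: commuting with [HOmega] means preserving the Euclidean norm. *)
Lemma ev_HOmega_bracket eps f z :
  ev (pbracket (HOmega N eps) f) z = Omega N eps * dot z (poly_vf f z).
Proof.
rewrite dot_symp /pbracket ev_sum mulr_sumr; apply: eq_bigr => j _.
rewrite !mderiv_HOmega -scaleN1r evD evZ !evM !evZ !ev_var.
by ring.
Qed.

Lemma dot_poly_vf eps f z : Omega N eps != 0 ->
  pbracket (HOmega N eps) f = 0 -> dot z (poly_vf f z) = 0.
Proof.
move=> O0 hb; have := ev_HOmega_bracket eps f z.
by rewrite hb ev0 => /esym/eqP; rewrite mulf_eq0 (negPf O0) => /eqP.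
Qed.

Lemma HOmega_bracket_self eps :
  pbracket (HOmega N eps) (HOmega N eps) = 0 :> hpoly R N.
Proof. by rewrite /pbracket big1 // => j _; rewrite mulrC subrr. Qed.

Lemma pbracketDr f g h : pbracket f (g + h) = pbracket f g + pbracket f h.
Proof.
rewrite /pbracket -big_split; apply: eq_bigr => j _.
by rewrite !mderivD /=; ring.
Qed.

Lemma HOmega_homog eps : homog 2 (HOmega N eps : hpoly R N).
Proof.
apply: homogZ; apply: homog_sum => j _ _.
have H k : homog 2 (var R k ^+ 2 : hpoly R N).
  rewrite /var mpolyXn; have := @homogX R _ (mnm_muln (mnm1 k) 2).
  by rewrite mdegMn mdeg1.
by apply: homogD; exact: H.
Qed.

End Hamiltonian.

(** * The remainder of the normal form *)

Section Remainder.
Variables (R : realType) (N : nat).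
Local Notation D := (sites N + sites N)%N.
Implicit Types z w : phase R N.

Lemma sum_half_le1 (k : nat) : \sum_(2 <= s < k) (2^-1 : R) ^+ s.-1 <= 1.
Proof.
case: (leqP 2 k) => [/subnK <-|k2]; last by rewrite big_geq ?ler01 // ltnW.
rewrite addnC; suff -> : \sum_(2 <= s < 2 + (k - 2)) (2^-1 : R) ^+ s.-1 =
    1 - 2^-1 ^+ (k - 2) by rewrite gerBl exprn_ge0 // invr_ge0.
elim: (k - 2)%N => [|m IH]; first by rewrite big_geq // expr0 subrr.
by rewrite addnS big_nat_recr //= IH exprS; field.
Qed.

Variables (Q : hpoly R N) (Hs : nat -> hpoly R N) (Ct M R0 : R).
Hypotheses (hQ : homog 4 Q) (Ct0 : 0 < Ct) (M0 : 0 <= M) (R0_gt0 : 0 < R0).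
(** With [t = s - 1], the degree [4 + 2 t] is at most [4 * 2^t], so its cube grows like [8^t] at
    most; the value 1/16 leaves a geometric series of ratio 1/2. *)
Hypothesis CtR0 : Ct * R0 ^+ 2 = 16^-1.
Hypothesis hHs : forall s, (2 <= s)%N ->
  homog (s.*2.+2) (Hs s) /\ polynorm (Hs s) <= M * Ct ^+ s.-1.

(** The degree is cubed: two powers for a Taylor expansion, and a third because the gradient is
    itself to be expanded. *)
Lemma remainder_weights k : \sum_(2 <= s < k)
  polynorm (Hs s) * (s.*2.+2)%:R ^+ 3 * R0 ^+ s.*2.+2 <= 64 * M * R0 ^+ 4.
Proof.
apply: (@le_trans _ _ (\sum_(2 <= s < k) 64 * M * R0 ^+ 4 * 2^-1 ^+ s.-1)).
  rewrite big_nat [leRHS]big_nat; apply: ler_sum => s /andP[s2 _].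
  have [_ pH] := hHs s2.
  move: pH; have [t ->] : exists t, s = t.+1 by exists s.-1; rewrite prednK // ltnW.
  move=> /= pH.
  have -> : (t.+1.*2.+2 = 4 + 2 * t)%N by lia.
  have le4 : (4 + 2 * t)%:R <= 4 * 2 ^+ t :> R.
    by rewrite -natrX -natrM ler_nat; have := ltn_expl t (isT : 1 < 2)%N; lia.
  apply: (@le_trans _ _ (M * Ct ^+ t * (4 * 2 ^+ t) ^+ 3 * R0 ^+ (4 + 2 * t))).
    rewrite ler_wpM2r ?exprn_ge0 ?(ltW R0_gt0) //.
    by apply: ler_pM; rewrite ?polynorm_ge0 ?exprn_ge0 // lerXn2r ?nnegrE.
  have -> : 2^-1 = 8 * (Ct * R0 ^+ 2) :> R by rewrite CtR0; field.
  rewrite exprD exprM !exprMn -exprM mulnC exprM.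
  rewrite (_ : 2 ^+ 3 = 8 :> R); last by ring.
  by rewrite le_eqVlt; apply/orP; left; apply/eqP; ring.
rewrite -mulr_sumr ler_piMr ?sum_half_le1 //.
by rewrite !mulr_ge0 ?exprn_ge0 // ltW.
Qed.

Let B := 64 * M * R0 ^+ 4.

Lemma remainder_weights2 k : \sum_(2 <= s < k)
  polynorm (Hs s) * (s.*2.+2)%:R ^+ 2 * R0 ^+ s.*2.+2 <= B.
Proof.
apply: le_trans (remainder_weights k); apply: ler_sum => s _.
rewrite ler_wpM2r ?exprn_ge0 ?(ltW R0_gt0) // ler_wpM2l ?polynorm_ge0 //.
by rewrite [leRHS]exprS ler_peMl ?exprn_ge0 // ler1n.
Qed.

Lemma remainder_weights_mderiv i k : \sum_(2 <= s < k)
  polynorm (mderiv i (Hs s)) * (s.*2.+1)%:R ^+ 2 * R0 ^+ s.*2.+1 <= B / R0.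
Proof.
rewrite ler_pdivlMr // mulr_suml; apply: le_trans (remainder_weights k).
rewrite big_nat [leRHS]big_nat; apply: ler_sum => s /andP[s2 _].
have [hH _] := hHs s2.
rewrite [leLHS](_ : _ = polynorm (mderiv i (Hs s)) * (s.*2.+1)%:R ^+ 2
  * R0 ^+ s.*2.+2); last by rewrite (exprSr R0 s.*2.+1) !mulrA.
rewrite ler_wpM2r ?exprn_ge0 ?(ltW R0_gt0) //.
rewrite [in leRHS]exprS mulrA.
apply: ler_pM; rewrite ?polynorm_ge0 ?exprn_ge0 //.
  by rewrite mulrC; exact: polynorm_mderiv.
by rewrite lerXn2r ?nnegrE // ler_nat.
Qed.

Definition dP2 (i : 'I_D) : phase R N -> R := sum_ev (fun s => mderiv i (Hs s)).

Lemma tangent_P2 (r : R) z : 0 <= r < R0 -> sbound r z ->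
  tangent (P2 Hs) z (fun i => dP2 i z).
Proof.
move=> rR bz; apply: (tangent_sum_ev R0_gt0 _ remainder_weights2 rR bz) => s s2.
by have [] := hHs s2.
Qed.

Lemma tangent_dP2 (r : R) z i : 0 <= r < R0 -> sbound r z ->
  exists G, tangent (dP2 i) z G.
Proof.
move=> rR bz; eexists.
apply: (tangent_sum_ev R0_gt0 _ (remainder_weights_mderiv i) rR bz) => s s2.
by have [hH _] := hHs s2; split => //; apply: (mderiv_homog i hH).
Qed.

Lemma dP2_bound (r : R) z i : 0 <= r < R0 -> sbound r z ->
  `|dP2 i z| <= B / R0 ^+ 6 * r ^+ 5.
Proof.
move=> /andP[r0 rR] bz.
have ha s : (2 <= s)%N -> (0 < s.*2.+2)%N /\ homog s.*2.+2 (Hs s).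
  by move=> s2; have [] := hHs s2.
have rR' : 0 <= r <= R0 by rewrite r0 ltW.
have [_ H] := sum_ev_mderiv R0_gt0 ha remainder_weights2 i rR' bz.
(* The lowest degree is 6, at [s = 2], hence the order 5 of the gradient. *)
by apply: H => s s2; lia.
Qed.

Definition XQ : phase R N -> phase R N := ham_vf (fun z => ev Q z + P2 Hs z).

Lemma ham_vf_normal_form d (f : hpoly R N) (r : R) z : homog d f ->
    0 <= r < R0 -> sbound r z ->
  ham_vf (fun w => ev (f + Q) w + P2 Hs w) z = poly_vf f z + XQ z.
Proof.
move=> hf rR bz.
have T := tangentD (tangent_homog z hQ) (tangent_P2 rR bz).
rewrite /XQ (ham_vf_tangent T).
have T2 := tangentD (tangent_homog z hf) T.
have -> : (fun w => ev (f + Q) w + P2 Hs w) =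
    (fun w => ev f w + (ev Q w + P2 Hs w)).
  by apply/funext => w; rewrite evD addrA.
by rewrite (ham_vf_tangent T2) sympD.
Qed.

Lemma XQ_E (r : R) z : 0 <= r < R0 -> sbound r z ->
  XQ z = poly_vf Q z + symp (fun i => dP2 i z).
Proof.
move=> rR bz.
have T := tangentD (tangent_homog z hQ) (tangent_P2 rR bz).
by rewrite /XQ (ham_vf_tangent T) sympD.
Qed.

Lemma differentiable_XQ (r : R) z : 0 <= r < R0 -> sbound r z ->
  differentiable XQ z.
Proof.
move=> /andP[r0 rR] bz.
suff H k : exists G, tangent (fun w => XQ w 0 k) z G.
  by have [G hG] := choice H; have [] := diff_of_tangents hG.
have [l [b hl]] := @symp_coord R N k.
have [|G hG] := @tangent_dP2 r z l _ bz; first by rewrite r0.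
have T := tangentD (tangent_homog z (mderiv_homog l hQ)) hG.
have [G' T'] : exists G', tangent (fun w => (-1) ^+ b *
    (ev (mderiv l Q) w + dP2 l w)) z G'.
  case: b {hl}; last first.
    eexists; apply: (tangent_near (ltr01 : 0 < 1 :> R) _ T) => h e _ _.
    by rewrite mul1r.
  eexists; apply: (tangent_near (ltr01 : 0 < 1 :> R) _ (tangentN T)) => h e _ _.
  by rewrite mulN1r.
(* The closed form [XQ_E] is available only inside radius [R0]; increments below [(R0 - r) / 2] keep
   [z + h] there. *)
exists G'; apply: (tangent_near (r := (R0 - r) / 2)) T' => [|h e /andP[e0 er] bh].
  by rewrite divr_gt0 // subr_gt0.
have bzh : sbound (r + e) (z + h) by exact: sboundD.
rewrite (XQ_E _ bzh); last by rewrite addr_ge0 //=; lra.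
by rewrite -sympD hl.
Qed.

Lemma dot_ham_vf (f : hpoly R N) (r : R) z : homog 2 f ->
    dot z (poly_vf f z) = 0 -> dot z (poly_vf Q z) = 0 ->
    0 <= r < R0 -> sbound r z ->
  `|dot z (ham_vf (fun w => ev (f + Q) w + P2 Hs w) z)|
    <= D%:R * (r * (B / R0 ^+ 6 * r ^+ 5)).
Proof.
move=> hf f0 Q0 rR bz.
rewrite (ham_vf_normal_form hf rR bz) (XQ_E rR bz) !dotDr f0 Q0 !add0r.
apply: dot_bound => //; last by case/andP: rR.
by apply: symp_bound => i; apply: dP2_bound.
Qed.

(** [E2] and [E4] collect what [K] drops from [L + Q]. Young's inequality splits twice the product
    of [delta] and the residual into [l |delta|^2] and [|res|^2 / l]; the weight [l] is left free so
    that the first term can be fitted below [kappa_0]. *)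
Lemma dot_vf_difference (L K E2 E4 : hpoly R N) (r k l b : R) z w :
    homog 2 L -> (forall v, dot v (poly_vf L v) = 0) ->
    homog 2 E2 -> homog 4 E4 ->
    (forall y, tangent (ev K) y (fun i => ev (mderiv i K) y)) ->
    K + E2 + E4 = L + Q ->
    0 <= r < R0 -> dot z z <= r ^+ 2 -> dot w w <= r ^+ 2 ->
    0 < k -> 0 < l ->
    (forall y v, dot y y <= r ^+ 2 -> enorm ('d XQ y v) <= k * enorm v) ->
    b = B / R0 ^+ 6 * r ^+ 5 + 2 * polynorm E2 * r + 4 * polynorm E4 * r ^+ 3 ->
  `|2 * dot (z - w)
     (ham_vf (fun w => ev (L + Q) w + P2 Hs w) z - ham_vf (ev K) w)|
    <= (2 * k + l) * dot (z - w) (z - w) + D%:R * (b * b) / l.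
Proof.
move=> hL L0 hE2 hE4 hK KE rR zr wr k0 l0 hd bE.
have r0 : 0 <= r by case/andP: rR.
have bz := sbound_dot r0 zr; have bw := sbound_dot r0 wr.
pose res := symp (fun i => dP2 i w) + poly_vf E2 w + poly_vf E4 w.
have bres : sbound b res.
  rewrite bE.
  apply: sboundD; first apply: sboundD.
  - by apply: symp_bound => i; exact: dP2_bound bw.
  - by have := poly_vf_bound hE2 r0 bw; rewrite expr1.
  - exact: (poly_vf_bound hE4 r0 bw).
have -> : ham_vf (fun w => ev (L + Q) w + P2 Hs w) z - ham_vf (ev K) w =
    poly_vf L (z - w) + ((XQ z - XQ w) + res).
  rewrite (ham_vf_normal_form hL rR bz) (ham_vf_tangent (hK w)) -/(poly_vf K w).
  have -> : poly_vf K w = poly_vf L w + poly_vf Q w - poly_vf E2 w - poly_vf E4 w.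
    rewrite -poly_vfD -KE !poly_vfD.
    by apply/rowP => i; rewrite !mxE; ring.
  have -> : poly_vf L z = poly_vf L (z - w) + poly_vf L w.
    by rewrite -poly_vf_linear // subrK.
  rewrite (XQ_E rR bw) /res.
  by apply/rowP => i; rewrite !mxE; ring.
rewrite (dotDr _ (poly_vf L _)) L0 add0r (dotDr _ (XQ z - XQ w)) mulrDr.
apply: le_trans (ler_normD _ _) _.
rewrite [(2 * k + l) * _]mulrDl -addrA; apply: lerD.
  rewrite normrM ger0_norm // -mulrA ler_wpM2l //.
  apply: dot_mvt => // s s01 y.
  have yr : dot y y <= r ^+ 2.
    apply: le_trans (dot_convex w z s01) _; case/andP: s01 => s0 s1.
    apply: (@le_trans _ _ ((1 - s) * r ^+ 2 + s * r ^+ 2)); last by lra.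
    by apply: lerD; rewrite ler_wpM2l // subr_ge0.
  split; first exact: differentiable_XQ rR (sbound_dot r0 yr).
  rewrite -!enorm_sqr -exprMn.
  by rewrite lerXn2r ?nnegrE ?mulr_ge0 ?enorm_ge0 ?(ltW k0) // hd.
have rr : dot res res <= D%:R * (b * b).
  have b0 : 0 <= b by apply: le_trans (bres (lshift _ ord0)).
  by apply: le_trans (ler_norm _) _; exact: dot_bound.
have rl : dot res res / l <= D%:R * (b * b) / l.
  by rewrite ler_wpM2r // invr_ge0 ltW.
apply: (@le_trans _ _ (l * dot (z - w) (z - w) + dot res res / l)); last by lra.
have := dot_young (z - w) res l0; have := dot_young (z - w) (- res) l0.
rewrite dotNr (_ : dot (- res) (- res) = dot res res); last first.
  by apply: eq_bigr => i _; rewrite !mxE mulrNN.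
by move=> *; rewrite ler_norml; apply/andP; split; lra.
Qed.

End Remainder.

(** * Two nearby orbits confined to a ball *)

Section TrappedFlow.
Variables (R : realType) (n : nat) (X Y : 'rV[R]_n -> 'rV[R]_n).
Variables (J : set R) (z w : R -> 'rV[R]_n) (rho q A k B T : R).
Hypotheses (Ji : is_interval J) (J0 : J 0).
Hypothesis hz : forall t, J t -> is_derive t (1 : R) z (X (z t)).
Hypothesis hw : forall t, J t -> is_derive t (1 : R) w (Y (w t)).
Hypotheses (q01 : 0 < q <= 1) (rho0 : 0 < rho) (A0 : 0 <= A) (B0 : 0 <= B)
  (k0 : 0 < k).
(** The square of the radius of the enlarged ball; all sizes in this section are squared. *)
Let M := 4 / 9 * (1 + q) * rho.
Hypothesis hA : forall y, dot y y < M -> `|2 * dot y (X y)| <= A.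
Hypothesis hB : forall y v, dot y y < M -> dot v v < M ->
  `|2 * dot (y - v) (X y - Y v)| <= k * dot (y - v) (y - v) + B.
Hypothesis z0_le : dot (z 0) (z 0) <= 4 / 9 * rho.
Hypothesis AT : A * T <= q / 9 * rho.
Let d0 := dot (z 0 - w 0) (z 0 - w 0).
Hypothesis dT : (1 + 4 / q) * ((d0 + B / k) * expR (k * T)) <= q / 9 * rho.

Lemma trapped_flow t : J t -> `|t| <= T ->
  dot (z t - w t) (z t - w t) <= (d0 + B / k) * expR (k * T).
Proof.
move=> Jt tT.
pose U s := dot (z s) (z s); pose V s := dot (w s) (w s).
pose W s := dot (z s - w s) (z s - w s).
pose dU s := 2 * dot (z s) (X (z s)); pose dV s := 2 * dot (w s) (Y (w s)).
pose dW s := 2 * dot (z s - w s) (X (z s) - Y (w s)).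
have hd s : J s -> [/\ is_derive s (1 : R) U (dU s),
      is_derive s (1 : R) V (dV s) & is_derive s (1 : R) W (dW s)].
  move=> Js; have zs := hz Js; have ws := hw Js.
  split; [exact: is_derive_sqr|exact: is_derive_sqr|].
  by apply: is_derive_sqr; exact: is_deriveB.
have dUle s : U s < M -> `|dU s| <= A by exact: hA.
have dWle s : U s < M -> V s < M -> `|dW s| <= k * W s + B by exact: hB.
have d00 : 0 <= d0 + B / k by rewrite addr_ge0 ?dot_ge0 // divr_ge0 // ltW.
have good s t1 : 0 <= t1 <= T -> U s <= U 0 + A * t1 ->
    W s <= (d0 + B / k) * expR (k * t1) -> U s < M /\ V s < M.
  move=> /andP[t10 t1T] Us Ws; case/andP: q01 => q0 q1.
  have {}Us : U s <= 4 / 9 * rho * (1 + q / 4).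
    have : A * t1 <= A * T by rewrite ler_wpM2l.
    by move: z0_le AT Us; rewrite /U => *; lra.
  have {}Ws : (1 + 4 / q) * W s <= q / 9 * rho.
    apply: le_trans dT; rewrite ler_wpM2l ?addr_ge0 ?divr_ge0 ?(ltW q0) //.
    by apply: le_trans Ws _; rewrite ler_wpM2l // ler_expR ler_wpM2l // ltW.
  have q4 : 0 < q / 4 by rewrite divr_gt0.
  have qr : 0 < q * rho by rewrite mulr_gt0.
  have qqr : q * q * rho <= q * rho.
    by rewrite ler_wpM2r ?(ltW rho0) // ler_piMr // ltW.
  split; first by rewrite /M; nra.
  (* The norm of [w] is reached through [w = z - (z - w)]. The margin is sufficient because
     [(1 + q/4)^2 + q/4 < 1 + q] for [0 < q <= 1]. *)
  have := dot_subr_le (z s) (z s - w s) q4.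
  rewrite (_ : z s - (z s - w s) = w s); last by rewrite subKr.
  rewrite -/(V s) -/(U s) -/(W s) invf_div => Vs.
  have : (1 + q / 4) * U s <= (1 + q / 4) * (4 / 9 * rho * (1 + q / 4)).
    by rewrite ler_wpM2l // addr_ge0 // ltW.
  by rewrite /M => *; nra.
(* Negative times are reached by running the clock with the sign of [t]; [hA] and [hB] bound
   absolute values, so they survive the reversal. At [t = 0] the sign vanishes, hence the separate
   case. *)
have Jsub s : 0 <= s <= `|t| -> J (Num.sg t * s).
  move=> /andP[s0 st].
  case: (ltgtP t 0) => t0.
  - move: st; rewrite ltr0_sg // mulN1r ltr0_norm // lerNr => st.
    by apply: (Ji Jt J0); rewrite st oppr_le0.
  - move: st; rewrite gtr0_sg // mul1r gtr0_norm // => st.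
    by apply: (Ji J0 Jt); rewrite s0.
  - by rewrite t0 sgr0 mul0r.
have tE : t = Num.sg t * `|t| by rewrite -numEsg.
have [] : Num.sg t * Num.sg t = 1 \/ t = 0.
- by case: (ltgtP t 0) => t0; [left; rewrite ltr0_sg // mulrNN mulr1|
    left; rewrite gtr0_sg // mulr1|right].
- move=> sg1.
  have hcomp (f df : R -> R) s : 0 <= s <= `|t| ->
      is_derive (Num.sg t * s) (1 : R) f (df (Num.sg t * s)) ->
      is_derive s (1 : R) (fun r => f (Num.sg t * r))
        (Num.sg t * df (Num.sg t * s)).
    move=> st hf.
    have hl : is_derive s (1 : R) (fun r => Num.sg t * r) (Num.sg t).
      have := @is_deriveZ _ _ _ id (Num.sg t) s 1 1 (is_derive_id _ _).
      by move=> h; apply: (is_derive_eq h); rewrite /GRing.scale /= mulr1.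
    have := @is_derive1_comp _ f (fun r => Num.sg t * r) s _ _ hf hl.
    by move=> h; apply: (is_derive_eq h); rewrite mulrC.
  have sgle (x : R) : Num.sg t * x <= `|x|.
    apply: le_trans (ler_norm _) _.
    by rewrite normrM ler_piMl // normr_sg lern1; case: (t != 0).
  have := @gronwall_trapped R (fun s => U (Num.sg t * s)) (fun s => V (Num.sg t * s))
    (fun s => W (Num.sg t * s)) (fun s => Num.sg t * dU (Num.sg t * s))
    (fun s => Num.sg t * dV (Num.sg t * s)) (fun s => Num.sg t * dW (Num.sg t * s))
    `|t| M A k B (normr_ge0 t) k0 B0 A0 _ _ _ _.
  rewrite mulr0 -tE => H.
  apply: (@le_trans _ _ ((d0 + B / k) * expR (k * `|t|))); last first.
    by rewrite ler_wpM2l // ler_expR ler_wpM2l // ltW.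
  apply: H.
  + move=> s st; have [HU HV HW] := hd _ (Jsub s st).
    by split; [exact: hcomp st HU|exact: hcomp st HV|exact: hcomp st HW].
  + move=> s st Us Vs; split; apply: le_trans (sgle _) _; [exact: dUle|exact: dWle].
  + exact: dot_ge0.
  + by move=> s st; apply: good; rewrite normr_ge0.
- move=> t0; rewrite t0 -/d0; apply: (@le_trans _ _ (d0 + B / k)).
    by rewrite lerDl divr_ge0 // ltW.
  rewrite ler_peMr // -expR0 ler_expR mulr_ge0 ?(ltW k0) //.
  by apply: le_trans tT.
Qed.
End TrappedFlow.

(** * Constants of the normal form *)

Section Constants.
Variable R : realType.

Lemma powR_invsqrt (x : R) : 0 < x -> x `^ (- (1 / 2)) = (Num.sqrt x)^-1.
Proof. by move=> x0; rewrite powRN div1r powR12_sqrt // ltW. Qed.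

Lemma powR_lt1_half (eps a : R) : 0 < eps < 1 / 2 -> 0 < a -> (2 * eps) `^ a < 1.
Proof.
move=> /andP[e0 e1] a0; have := @gt0_ltr_powR R a a0 (2 * eps) 1.
by rewrite powR1; apply; rewrite ?nnegrE; lra.
Qed.

(** This halving is what will separate the Lipschitz constant from [kappa_0] by a fixed amount. *)
Lemma powR_sixteenth (e s : R) : 0 < e <= s / 16 ->
  (2 * e) `^ (1 / 4) <= (2 * s) `^ (1 / 4) / 2.
Proof.
move=> /andP[e0 es].
have -> : 2^-1 = (16^-1) `^ (1 / 4) :> R.
  have -> : 16^-1 = (2^-1) ^+ 4 :> R by field.
  rewrite -powR_mulrn // -powRrM [X in _ `^ X](_ : _ = 1) ?powRr1 //.
  by field.
rewrite -powRM //; last by lra.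
by apply: ge0_ler_powR => //; rewrite ?nnegrE; lra.
Qed.

Section Threshold.
Variables (N : nat) (Cz Ch eps : R).
Hypotheses (Cz0 : 0 < Cz) (Ch0 : 0 < Ch) (heps : 0 < eps < 1 / 2).
Hypothesis hf : 1 < f_thr N Cz eps.

Let P := (1 - 2 * eps) * (1 - (2 * eps) `^ (3 / 4)).
Let P0 : 0 < P.
Proof.
case/andP: (heps) => e0 e1.
by rewrite mulr_gt0 // subr_gt0 ?powR_lt1_half //; lra.
Qed.

(** This is the condition [f_thr > 1] rearranged. It yields the positivity of [Omega] without
    looking into the matrix square root. *)
Lemma Omega_lb : 64 * Cz / 3 * Num.sqrt (2 * eps) < Omega N eps * P.
Proof.
case/andP: (heps) => e0 e1.
have s0 : 0 < Num.sqrt (2 * eps) by rewrite sqrtr_gt0; lra.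
move: hf; rewrite /f_thr -/P.
rewrite (_ : _ * (P / _) = (3 * (Omega N eps * P)) / (64 * Cz * Num.sqrt (2 * eps))).
  by rewrite ltr_pdivlMr ?mulr_gt0 // mul1r => *; lra.
by field; rewrite !gt_eqF.
Qed.

Lemma Omega_gt0 : 0 < Omega N eps.
Proof.
have := Omega_lb; case/andP: (heps) => e0 _.
have s0 : 0 < 64 * Cz / 3 * Num.sqrt (2 * eps).
  by rewrite !mulr_gt0 ?sqrtr_gt0 //; lra.
by move=> /(lt_trans s0); rewrite pmulr_lgt0.
Qed.

(** On the enlarged ball [(1 + q) * rho] must lie below [rho_star]. As [rho <= eps^2], a lower bound
    of order [sqrt eps] ensures this for small [eps]. It holds because [f_thr > 1] gives both
    [gamma >= Omega] and a lower bound on [Omega]. *)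
Lemma rho_star_lb :
  Cz / (6 * (1 + expR 1) * Ch) * Num.sqrt (2 * eps) <= rho_star N Cz Ch eps.
Proof.
have O0 := Omega_gt0; have OP := Omega_lb.
have E0 : 0 < 1 + expR 1 :> R by rewrite addr_gt0 // expR_gt0.
set g := gamma N Cz eps.
have gO : Omega N eps <= g.
  rewrite /g /gamma; have := hf; set f := f_thr _ _ _ => f1.
  have : (2 * f)^-1 <= 2^-1 by rewrite lef_pV2 ?posrE; lra.
  by move=> h; nra.
have g0 : 0 < g by exact: lt_le_trans gO.
have -> : rho_star N Cz Ch eps = g * P / (128 * (1 + expR 1) * Ch).
  rewrite /rho_star /Cstar -/g /P; set p1 := 1 - 2 * eps.
  set p2 := 1 - _ `^ _.
  have : p1 * p2 != 0 by rewrite gt_eqF //; exact: P0.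
  rewrite mulf_eq0 negb_or => /andP[p10 p20].
  by field; rewrite p10 p20 !gt_eqF.
rewrite ler_pdivlMr ?mulr_gt0 //.
rewrite (_ : _ * Num.sqrt _ * _ = 64 * Cz / 3 * Num.sqrt (2 * eps)); last first.
  by field; rewrite !gt_eqF.
by apply: (le_trans (ltW OP)); rewrite ler_wpM2r // ltW.
Qed.

End Threshold.
End Constants.

(** * Splitting of the normal form and size of its pieces *)

Section NormalFormFacts.
Variables (R : realType) (N : nat) (Cz Ch Ct eps : R).
Variables (X1 : hpoly R N) (zeta1 Hs : nat -> hpoly R N).
Hypotheses (hN : (2 <= N)%N) (Cz0 : 0 < Cz) (Ch0 : 0 < Ch) (Ct0 : 0 < Ct).
Hypothesis heps : 0 < eps < 1 / 2.
Hypothesis hz0 : classD 2 Cz (2 * eps) (zeta0 N eps).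
Hypothesis hf : 1 < f_thr N Cz eps.
Hypothesis nf : normal_form Cz Ch Ct eps X1 zeta1 Hs.

Definition far_coupling : hpoly R N := cyc (\sum_(3 <= m < N.+1) zeta0 N eps m).
Definition far_quartic : hpoly R N := cyc (\sum_(1 <= m < N.+1) zeta1 m).

Lemma classD_cyc_homog d C mu (f : nat -> hpoly R N) a :
  classD d C mu f -> homog d (cyc (\sum_(a <= m < N.+1) f m)).
Proof.
case=> _ _ hfm; apply: cyc_homog; apply: homog_sum => m.
rewrite mem_index_iota ltnS => /andP[_ mN] _.
by have [] := hfm m mN.
Qed.

(** Each component from index [a] on is bounded by the first weight [mu ^+ a], and there are at most
    [N + 1] of them. The orders [eps^3] and [eps] of the dropped terms are the cases [a = 3] and
    [a = 1]. *)
Lemma classD_cyc_norm d C mu (f : nat -> hpoly R N) a : classD d C mu f ->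
  polynorm (cyc (\sum_(a <= m < N.+1) f m))
    <= (sites N)%:R * (N.+1%:R * (C * mu ^+ a)).
Proof.
case=> C0 /andP[mu0 mu1] hfm.
have H m : m \in index_iota a N.+1 -> polynorm (f m) <= C * mu ^+ a.
  rewrite mem_index_iota ltnS => /andP[am mN].
  have [_ _ H] := hfm m mN; apply: le_trans H _.
  by rewrite ler_wpM2l ?(ltW C0) // ler_wiXn2l // ltW.
apply: le_trans (polynorm_cyc_sum H) _.
rewrite ler_wpM2l // ler_wpM2r ?mulr_ge0 ?exprn_ge0 ?(ltW C0) ?(ltW mu0) //.
by rewrite size_iota ler_nat leq_subr.
Qed.

Lemma seed_sumE (f : nat -> hpoly R N) : seed_sum f = \sum_(0 <= m < N.+1) f m.
Proof. by rewrite /seed_sum big_mkord. Qed.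

Lemma K_eff_far : K_eff eps zeta1 + far_coupling + far_quartic =
  (HOmega N eps + Z0 N eps) + Z1 zeta1.
Proof.
rewrite /K_eff /Z0 /Z1 !seed_sumE /far_coupling /far_quartic.
have -> : \sum_(0 <= m < N.+1) zeta0 N eps m = zeta0 N eps 1 +
    (zeta0 N eps 2 + \sum_(3 <= m < N.+1) zeta0 N eps m).
  (* [N >= 2] puts both retained couplings among the components of the seed. *)
  have l1 : (1 < N.+1)%N by rewrite ltnS ltnW.
  have l2 : (2 < N.+1)%N by rewrite ltnS.
  have z00 : zeta0 N eps 0 = 0 by [].
  by rewrite big_ltn // z00 add0r (big_ltn l1) (big_ltn l2).
have -> : \sum_(0 <= m < N.+1) zeta1 m = zeta1 0%N +
    \sum_(1 <= m < N.+1) zeta1 m by rewrite big_ltn.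
by rewrite !cycD; ring.
Qed.

Lemma quadratic_homog : homog 2 (HOmega N eps + Z0 N eps).
Proof.
apply: homogD; first exact: HOmega_homog.
by rewrite /Z0 seed_sumE; apply: classD_cyc_homog hz0.
Qed.

Lemma dot_quadratic v : dot v (poly_vf (HOmega N eps + Z0 N eps) v) = 0.
Proof.
have O0 : Omega N eps != 0 by rewrite gt_eqF // (@Omega_gt0 _ N Cz).
apply: (dot_poly_vf v O0).
by rewrite pbracketDr HOmega_bracket_self add0r; case: (nf_comm nf).
Qed.

Lemma dot_Z1 v : dot v (poly_vf (Z1 zeta1) v) = 0.
Proof.
have O0 : Omega N eps != 0 by rewrite gt_eqF // (@Omega_gt0 _ N Cz).
by apply: (dot_poly_vf v O0); case: (nf_comm nf).
Qed.

Lemma Z1_homog : homog 4 (Z1 zeta1).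
Proof. by rewrite /Z1 seed_sumE; apply: classD_cyc_homog (nf_zeta1 nf). Qed.

Lemma far_coupling_norm :
  polynorm far_coupling <= (sites N)%:R * (N.+1%:R * (Cz * 8)) * eps ^+ 3.
Proof.
apply: le_trans (classD_cyc_norm 3 hz0) _.
by rewrite le_eqVlt; apply/orP; left; apply/eqP; ring.
Qed.

Lemma far_quartic_norm :
  polynorm far_quartic <= (sites N)%:R * (N.+1%:R * (Ch * 2)) * eps.
Proof.
apply: le_trans (classD_cyc_norm 1 (nf_zeta1 nf)) _.
by rewrite le_eqVlt; apply/orP; left; apply/eqP; ring.
Qed.

Lemma Hs_facts s : (2 <= s)%N -> homog (s.*2.+2) (Hs s) /\
  polynorm (Hs s) <= (sites N)%:R * (N.+1%:R * (2 * Ch)) * Ct ^+ s.-1.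
Proof.
move=> s2; have [g hg ->] := nf_remainder nf s2.
rewrite seed_sumE; split; first exact: classD_cyc_homog hg.
apply: le_trans (classD_cyc_norm 0 hg) _.
by rewrite le_eqVlt; apply/orP; left; apply/eqP; ring.
Qed.

Lemma tangent_K_eff (y : phase R N) : tangent (ev (K_eff eps zeta1)) y
  (fun i => ev (mderiv i (K_eff eps zeta1)) y).
Proof.
pose f := HOmega N eps + cyc (zeta0 N eps 1) + cyc (zeta0 N eps 2).
have [_ _ h0] := hz0; have [_ _ h1] := nf_zeta1 nf.
have hf2 : homog 2 f.
  have H m : (m <= N)%N -> homog 2 (cyc (zeta0 N eps m)).
    by move=> mN; apply: cyc_homog; have [] := h0 m mN.
  apply: homogD; last exact: H.
  by apply: homogD; [exact: HOmega_homog|exact: H (ltnW hN)].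
have hg : homog 4 (cyc (zeta1 0%N)) by apply: cyc_homog; have [] := h1 0%N isT.
have T := tangentD (tangent_homog y hf2) (tangent_homog y hg).
have E1 : (fun w => ev f w + ev (cyc (zeta1 0)) w) = ev (K_eff eps zeta1).
  by apply/funext => w; rewrite -evD.
have E2 : (fun i => ev (mderiv i f) y + ev (mderiv i (cyc (zeta1 0))) y) =
   (fun i => ev (mderiv i (K_eff eps zeta1)) y).
  by apply/funext => w; rewrite -evD -mderivD.
by rewrite -E1 -E2.
Qed.

End NormalFormFacts.

(** * The estimate *)

Section FixedParameters.
Variables (R : realType) (N : nat) (Czeta0 Ch1 Ct C1 eps : R).
Variables (X1 : hpoly R N) (zeta1 Hs : nat -> hpoly R N).
Hypotheses (hN : (2 <= N)%N) (hCzeta0 : 0 < Czeta0) (hCh1 : 0 < Ch1)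
  (hCt : 0 < Ct).
Hypotheses (e0 : 0 < eps) (e2 : eps < 1 / 2).
Hypothesis hzeta0 : classD 2 Czeta0 (2 * eps) (zeta0 N eps).
Hypothesis hf : 1 < f_thr N Czeta0 eps.
Hypothesis nf : normal_form Czeta0 Ch1 Ct eps X1 zeta1 Hs.
Hypothesis hXN : XN_bound Czeta0 Ch1 C1 eps zeta1 Hs.

(* kap1 bounds the constant of XN_bound; its gap to kap0 pays for enlarging the
   ball by the factor sqrt (1 + q) and for the residual. *)
Variables (kap0 kap1 q l : R).
Hypotheses (kap00 : 0 < kap0) (kap10 : 0 < kap1) (q0 : 0 < q) (q1 : q <= 1)
  (l0 : 0 < l).
Hypothesis kap_gap : 2 * (kap1 * (1 + q)) + l <= 2 * kap0.
Hypothesis kap1_ge : C1 * Ch1 / (1 - (2 * eps) `^ (1 / 4)) ^+ 2 <= kap1.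

(** Constants free of [rho] and [eps], kept opaque through equations: [C5] bounds the gradient of
    [P2] against [r^5], [c1] is the constant of [rho_star_lb], [c2] and [c4] those of the dropped
    couplings and quartic terms, [b0] that of the whole residual, [Cw] that of the squared error.
    Below, [x] is the square root of [rho] and [E] the growth factor; [hAT] and [hE] are the two
    trapping conditions divided by [rho]. *)
Variables (R0 M C5 c1 c2 c4 D b0 Cw : R).
Hypotheses (R0_gt0 : 0 < R0) (CtR0 : Ct * R0 ^+ 2 = 16^-1).
Hypotheses (ME : M = (sites N)%:R * (N.+1%:R * (2 * Ch1)))
  (C5E : C5 = 64 * M * R0 ^+ 4 / R0 ^+ 6)
  (c1E : c1 = Czeta0 / (6 * (1 + expR 1) * Ch1))
  (c2E : c2 = (sites N)%:R * (N.+1%:R * (Czeta0 * 8)))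
  (c4E : c4 = (sites N)%:R * (N.+1%:R * (Ch1 * 2)))
  (DE : D = (sites N + sites N)%:R)
  (b0E : b0 = C5 + 2 * c2 + 4 * c4)
  (CwE : Cw = 1 + D * b0 ^+ 2 / (2 * l * kap0)).

Variables (rho T x E : R).
Hypotheses (heR : eps < R0) (hec : eps <= c1 / 4)
  (hrho : 0 < rho) (hrhoe : rho <= eps ^+ 2).
Hypotheses (x0 : 0 < x) (xx : x ^+ 2 = rho) (EE : E = expR (kap0 * (rho * T))).
Hypothesis hAT : 2 * D * C5 * (x * (x * (rho * T))) <= q / 9.
Hypothesis hE : (1 + 4 / q) * Cw * (E * (eps ^+ 3 / rho)) ^+ 2 <= q / 9.

Let he : 0 < eps < 1 / 2. Proof. by rewrite e0. Qed.
Let M0 : 0 <= M. Proof. by rewrite ME !mulr_ge0 // ltW. Qed.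
Let C50 : 0 <= C5.
Proof. by rewrite C5E divr_ge0 ?mulr_ge0 ?exprn_ge0 // ltW. Qed.
Let c10 : 0 < c1.
Proof. by rewrite c1E divr_gt0 // !mulr_gt0 // addr_gt0 // expR_gt0. Qed.
Let c20 : 0 <= c2. Proof. by rewrite c2E !mulr_ge0 // ltW. Qed.
Let c40 : 0 <= c4. Proof. by rewrite c4E !mulr_ge0 // ltW. Qed.
Let b00 : 0 <= b0. Proof. by rewrite b0E !addr_ge0 // mulr_ge0. Qed.
Let D0 : 0 <= D. Proof. by rewrite DE. Qed.
Let l0' : 0 <= l. Proof. exact: ltW. Qed.
Let Cw1 : 1 <= Cw.
Proof. by rewrite CwE lerDl divr_ge0 ?mulr_ge0 ?exprn_ge0 // ltW. Qed.
Let xe : x <= eps.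
Proof. by rewrite -(@ler_pXn2r _ 2) ?nnegrE ?(ltW x0) ?(ltW e0) // xx. Qed.

Lemma in_ball_dot (s : R) (y : phase R N) : 0 <= s ->
  in_ball s y = (dot y y <= 4 / 9 * s).
Proof.
move=> s0; rewrite /in_ball enorm_le ?mulr_ge0 ?sqrtr_ge0 //.
rewrite exprMn sqr_sqrtr //; congr (_ <= _ * _).
by field.
Qed.

Let r := 2 / 3 * Num.sqrt ((1 + q) * rho).
Let q10 : 0 < 1 + q. Proof. exact: addr_gt0. Qed.
Let r0 : 0 <= r. Proof. by rewrite mulr_ge0 ?sqrtr_ge0 // divr_ge0. Qed.
Let rr : r ^+ 2 = 4 / 9 * (1 + q) * rho.
Proof.
rewrite exprMn sqr_sqrtr; last by rewrite mulr_ge0 // ltW.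
by field.
Qed.
Let rx : r <= x.
Proof.
rewrite -(@ler_pXn2r _ 2) ?nnegrE ?(ltW x0) // rr xx.
rewrite ler_piMl ?(ltW hrho) //.
by have := q1; lra.
Qed.
Let rR : 0 <= r < R0.
Proof. by rewrite r0 (le_lt_trans rx) // (le_lt_trans xe). Qed.

Lemma enlarged_rho_lt : 0 < (1 + q) * rho < rho_star N Czeta0 Ch1 eps.
Proof.
rewrite mulr_gt0 //=.
apply: (lt_le_trans _ (rho_star_lb hCzeta0 hCh1 he hf)).
rewrite -c1E; set s := Num.sqrt (2 * eps).
have s0 : 0 < s by rewrite sqrtr_gt0 mulr_gt0.
have es : eps <= s.
  rewrite -(@ler_pXn2r _ 2) ?nnegrE ?(ltW s0) ?(ltW e0) //.
  by rewrite sqr_sqrtr ?mulr_ge0 ?(ltW e0) //; have := e0; have := e2; nra.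
have h1 : (1 + q) * rho <= 2 * eps ^+ 2.
  by apply: ler_pM => //; [exact: ltW|exact: ltW|have := q1; lra].
have h2 : eps * eps <= c1 / 4 * s by apply: ler_pM => //; exact: ltW e0.
have h3 : 0 < c1 * s by rewrite mulr_gt0.
by rewrite expr2 in h1; lra.
Qed.

(** [XN_bound] holds for every admissible radius, so it is applied with [(1 + q) * rho] in place of
    [rho]; the price is the factor [1 + q]. *)
Lemma XN_lip (y v : phase R N) : dot y y <= r ^+ 2 ->
  enorm ('d (XN zeta1 Hs) y v) <= kap1 * (1 + q) * rho * enorm v.
Proof.
move=> yr.
have yb : in_ball ((1 + q) * rho) y by rewrite /in_ball -/r enorm_le.
apply: le_trans (hXN v enlarged_rho_lt yb) _.
rewrite ler_wpM2r ?enorm_ge0 // -[leRHS]mulrA mulrAC.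
by rewrite ler_wpM2r // mulr_ge0 // ltW.
Qed.

Let rxn k : r ^+ k <= x ^+ k.
Proof. by rewrite lerXn2r ?nnegrE ?(ltW x0). Qed.

Lemma norm_growth (y : phase R N) : dot y y <= r ^+ 2 ->
  `|2 * dot y (ham_vf (H_nf eps zeta1 Hs) y)|
    <= 2 * D * C5 * rho ^+ 3.
Proof.
move=> yr; have := Hs_facts nf; rewrite -ME => hHs.
have := dot_ham_vf (Z1_homog nf) hCt M0 R0_gt0 CtR0 hHs
  (quadratic_homog hzeta0) (dot_quadratic hCzeta0 he hf nf y)
  (dot_Z1 hCzeta0 he hf nf y) rR (sbound_dot r0 yr).
rewrite -C5E -DE => h; rewrite normrM ger0_norm //.
rewrite -!mulrA ler_wpM2l //; apply: le_trans h _; rewrite ler_wpM2l //.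
rewrite mulrCA ler_wpM2l // -exprS.
by apply: le_trans (rxn 6) _; rewrite -xx -exprM.
Qed.

(** The Young weight is [l * rho], proportional to the Lipschitz constant, so that [kap_gap] covers
    both. The squared residual is of order [rho * eps^6], and the division by this weight leaves
    [eps^6]. *)
Lemma difference_growth (y v : phase R N) :
    dot y y <= r ^+ 2 -> dot v v <= r ^+ 2 ->
  `|2 * dot (y - v) (ham_vf (H_nf eps zeta1 Hs) y
                     - ham_vf (ev (K_eff eps zeta1)) v)|
    <= 2 * kap0 * rho * dot (y - v) (y - v) + D * b0 ^+ 2 * eps ^+ 6 / l.
Proof.
move=> yr vr; have := Hs_facts nf; rewrite -ME => hHs.
have k0 : 0 < kap1 * (1 + q) * rho by rewrite !mulr_gt0.
have lr : 0 < l * rho by rewrite mulr_gt0.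
have := dot_vf_difference (Z1_homog nf) hCt M0 R0_gt0 CtR0 hHs
  (quadratic_homog hzeta0) (dot_quadratic hCzeta0 he hf nf)
  (classD_cyc_homog 3 hzeta0) (classD_cyc_homog 1 (nf_zeta1 nf))
  (tangent_K_eff hN hzeta0 nf) (K_eff_far eps zeta1 hN)
  rR yr vr k0 lr XN_lip (erefl _).
rewrite -C5E -DE; set b := C5 * r ^+ 5 + _ + _ => h; apply: le_trans h _.
apply: lerD.
  rewrite ler_wpM2r ?dot_ge0 //.
  have := kap_gap => g; have : rho * (2 * (kap1 * (1 + q)) + l) <= rho * (2 * kap0).
    by rewrite ler_wpM2l // ltW.
  by move=> ?; lra.
(* The three sources of the residual have sizes [x^5], [eps^3 x] and [eps x^3]; all are at most of
   order [x eps^3] because [x <= eps]. *)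
have bE : b <= b0 * (x * eps ^+ 3).
  have e1 : eps <= 1 by by have := e2; lra.
  have t1 : C5 * r ^+ 5 <= C5 * (x * eps ^+ 3).
    rewrite ler_wpM2l //; apply: le_trans (rxn 5) _.
    rewrite exprS ler_wpM2l ?(ltW x0) //.
    apply: (@le_trans _ _ (eps ^+ 4)).
      by rewrite lerXn2r ?nnegrE ?(ltW x0) ?(ltW e0).
    by rewrite ler_wiXn2l // ltW.
  have t2 : polynorm (far_coupling N eps) * r <= c2 * (x * eps ^+ 3).
    rewrite [leRHS](_ : _ = c2 * eps ^+ 3 * x); last by ring.
    apply: ler_pM => //; first exact: polynorm_ge0.
    by rewrite c2E; exact: far_coupling_norm.
  have t3 : polynorm (far_quartic zeta1) * r ^+ 3 <= c4 * (x * eps ^+ 3).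
    apply: (@le_trans _ _ (c4 * eps * x ^+ 3)).
      apply: ler_pM; rewrite ?polynorm_ge0 ?exprn_ge0 ?rxn //.
      by rewrite c4E; exact: (far_quartic_norm nf).
    rewrite -!mulrA ler_wpM2l // [x ^+ 3]exprS mulrCA ler_wpM2l ?(ltW x0) //.
    rewrite [eps ^+ 3]exprS ler_wpM2l ?(ltW e0) //.
    by rewrite lerXn2r ?nnegrE ?(ltW x0) ?(ltW e0).
  by move: t1 t2 t3; rewrite /b b0E /far_coupling /far_quartic => *; lra.
have b_ge0 : 0 <= b.
  by rewrite /b !addr_ge0 ?mulr_ge0 ?exprn_ge0 ?polynorm_ge0.
rewrite [leRHS](_ : _ = D * (b0 * (x * eps ^+ 3)) ^+ 2 / (l * rho)); last first.
  by rewrite !exprMn xx; field; rewrite !gt_eqF.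
rewrite ler_wpM2r ?invr_ge0 ?(ltW lr) // ler_wpM2l // -expr2 lerXn2r ?nnegrE //.
by rewrite !mulr_ge0 ?exprn_ge0 // ltW.
Qed.

Lemma fixed_parameters_bound (J : set R) (z w : R -> phase R N) t :
    is_interval J -> J 0 ->
    ham_solution (H_nf eps zeta1 Hs) J z ->
    ham_solution (ev (K_eff eps zeta1)) J w ->
    in_ball rho (z 0) -> enorm (z 0 - w 0) <= x^-1 * eps ^+ 3 ->
    J t -> `|t| <= T ->
  enorm (z t - w t) <= Num.sqrt Cw * E * x^-1 * eps ^+ 3.
Proof.
move=> Ji J0 hz hw zb dz Jt tT.
set B := D * b0 ^+ 2 * eps ^+ 6 / l.
have B0 : 0 <= B by rewrite divr_ge0 ?mulr_ge0 ?exprn_ge0 // ltW.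
have k0 : 0 < 2 * kap0 * rho by rewrite !mulr_gt0.
have EE2 : expR (2 * kap0 * rho * T) = E ^+ 2.
  by rewrite EE -expRM_natl; congr expR; ring.
have d0 : dot (z 0 - w 0) (z 0 - w 0) <= eps ^+ 6 / rho.
  have := dz; rewrite enorm_le ?mulr_ge0 ?exprn_ge0 ?invr_ge0 ?(ltW x0) ?(ltW e0) //.
  by rewrite exprMn exprVn xx -exprM mulrC.
(* Origin of [Cw]: the initial error contributes 1, and the forcing [B] divided by the rate
   [2 * kap0 * rho] contributes the rest. *)
have dB : dot (z 0 - w 0) (z 0 - w 0) + B / (2 * kap0 * rho)
    <= Cw * (eps ^+ 6 / rho).
  rewrite [leRHS](_ : _ = eps ^+ 6 / rho + B / (2 * kap0 * rho)).
    by rewrite lerD2r.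
  by rewrite CwE /B; field; rewrite !gt_eqF.
have E0 : 0 < E by rewrite EE expR_gt0.
have := @trapped_flow R _ (ham_vf (H_nf eps zeta1 Hs))
  (ham_vf (ev (K_eff eps zeta1))) J z w rho q (2 * D * C5 * rho ^+ 3)
  (2 * kap0 * rho) B T Ji J0 hz hw _ hrho _ B0 k0 _ _ _ _ _ t Jt tT.
rewrite EE2 => H; rewrite enorm_le; last first.
  by rewrite !mulr_ge0 ?sqrtr_ge0 ?exprn_ge0 ?invr_ge0 // ltW.
apply: (@le_trans _ _ (Cw * (eps ^+ 6 / rho) * E ^+ 2)); last first.
  rewrite -{1}(sqr_sqrtr (le_trans ler01 Cw1)) -xx le_eqVlt.
  by apply/orP; left; apply/eqP; field; rewrite gt_eqF.
apply: (le_trans (H _ _ _ _ _ _ _)); last first.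
- by rewrite ler_wpM2r // exprn_ge0 // ltW.
- apply: (@le_trans _ _ ((1 + 4 / q) * (Cw * (eps ^+ 6 / rho) * E ^+ 2))).
    rewrite ler_wpM2l ?addr_ge0 ?divr_ge0 ?(ltW q0) //.
    by rewrite ler_wpM2r // exprn_ge0 // ltW.
  rewrite [leLHS](_ : _ = (1 + 4 / q) * Cw * (E * (eps ^+ 3 / rho)) ^+ 2 * rho).
    by rewrite ler_wpM2r // ltW.
  by field; rewrite !gt_eqF.
- rewrite [leLHS](_ : _ = 2 * D * C5 * (x * (x * (rho * T))) * rho).
    by rewrite ler_wpM2r // ltW.
  by rewrite [x * (x * _)]mulrA -expr2 xx; ring.
- by rewrite -in_ball_dot // ltW.
- by move=> y v yM vM; apply: difference_growth; rewrite rr ltW.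
- by move=> y yM; apply: norm_growth; rewrite rr ltW.
- by rewrite !mulr_ge0 ?exprn_ge0 // ltW.
- by rewrite q0.
Qed.

End FixedParameters.

(** * Choice of the constants, uniformly in [rho] and [eps] *)

Section Core.
Variables (R : realType) (N : nat) (Czeta0 Ch1 Ct C1 eps_star : R).
Variables (X1 : R -> hpoly R N) (zeta1 Hs : R -> nat -> hpoly R N).
Hypotheses (hN : (2 <= N)%N) (hCzeta0 : 0 < Czeta0) (hCh1 : 0 < Ch1)
  (hCt : 0 < Ct) (hC1 : 0 < C1) (heps_star : 0 < eps_star < 1 / 2).
Hypothesis hzeta0 : forall eps, 0 < eps < eps_star ->
  classD 2 Czeta0 (2 * eps) (zeta0 N eps).
Hypothesis hf : forall eps, 0 < eps < eps_star -> 1 < f_thr N Czeta0 eps.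
Hypothesis hnf : forall eps, 0 < eps < eps_star ->
  normal_form Czeta0 Ch1 Ct eps (X1 eps) (zeta1 eps) (Hs eps).
Hypothesis hXN : forall eps, 0 < eps < eps_star ->
  XN_bound Czeta0 Ch1 C1 eps (zeta1 eps) (Hs eps).

Local Notation kap0 := (kappa0 C1 Ch1 eps_star).

Lemma kappa0_gap : exists kap1, [/\ 0 < kap1, kap1 < kap0 &
  forall eps, 0 < eps <= eps_star / 16 ->
    C1 * Ch1 / (1 - (2 * eps) `^ (1 / 4)) ^+ 2 <= kap1].
Proof.
case/andP: (heps_star) => s0 s1; pose a := (2 * eps_star) `^ (1 / 4).
have a0 : 0 < a by rewrite powR_gt0 // mulr_gt0.
have a1 : a < 1 by rewrite powR_lt1_half // ?heps_star //; lra.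
have C10 : 0 < C1 * Ch1 by rewrite mulr_gt0.
have a20 : 0 < 1 - a / 2 by lra.
exists (C1 * Ch1 / (1 - a / 2) ^+ 2); split.
- by rewrite divr_gt0 // exprn_gt0.
- rewrite /kappa0 -/a ltr_pM2l // ltf_pV2 ?posrE ?exprn_gt0 //; last by lra.
  by rewrite ltrXn2r ?nnegrE //; lra.
- move=> eps he; have pa := powR_sixteenth he.
  rewrite ler_pM2l // lef_pV2 ?posrE ?exprn_gt0 //; last by rewrite -/a in pa; lra.
  by rewrite lerXn2r ?nnegrE //; rewrite -/a in pa; lra.
Qed.

Lemma kappa0_gt0 : 0 < kap0.
Proof. by have [k [k0 kk _]] := kappa0_gap; exact: lt_trans kk. Qed.

(** Common form of the two parts of the theorem: [tau] limits the drift of the norm of [z], and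
    [eta1] keeps [delta] small compared with [sqrt rho]. *)
Lemma approximation_estimate (tau : R) : 0 < tau -> exists e1 eta1 C : R,
  [/\ 0 < e1, 0 < eta1, 0 < C & forall eps rho T : R,
    0 < eps < eps_star -> eps <= e1 -> 0 < rho -> rho <= eps ^+ 2 -> 0 <= T ->
    Num.sqrt rho * (rho * T) <= tau ->
    expR (kap0 * (rho * T)) * (eps ^+ 3 / rho) <= eta1 ->
    forall (J : set R) (z w : R -> phase R N), is_interval J -> J 0 ->
      ham_solution (H_nf eps (zeta1 eps) (Hs eps)) J z ->
      ham_solution (ev (K_eff eps (zeta1 eps))) J w ->
      in_ball rho (z 0) ->
      enorm (z 0 - w 0) <= rho `^ (- (1 / 2)) * eps ^+ 3 ->
      forall t, J t -> `|t| <= T ->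
        enorm (z t - w t)
          <= C * expR (kap0 * (rho * T)) * rho `^ (- (1 / 2)) * eps ^+ 3].
Proof.
move=> tau0; have [kap1 [kap10 kap1_lt hkap1]] := kappa0_gap.
have kap00 := kappa0_gt0.
(* The gap [2 * (kap0 - kap1)] is shared equally: one half is the Young weight [l], the other pays
   for the enlargement [q]. *)
have [l [l0 lE]] : exists l, 0 < l /\ l = kap0 - kap1.
  by exists (kap0 - kap1); rewrite subr_gt0.
have [q [q0 q1 ql]] : exists q, [/\ 0 < q, q <= 1 & q * (2 * kap1) <= l].
  exists (Num.min 1 (l / (2 * kap1))); split.
  - by rewrite lt_min ltr01 /= divr_gt0 // mulr_gt0.
  - by rewrite ge_min lexx.
  - by rewrite -ler_pdivlMr ?mulr_gt0 // ge_min lexx orbT.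
have kap_gap : 2 * (kap1 * (1 + q)) + l <= 2 * kap0 by lra.
have [R0 [R00 CtR0]] : exists R0 : R, 0 < R0 /\ Ct * R0 ^+ 2 = 16^-1.
  have s0 : 0 < Num.sqrt Ct by rewrite sqrtr_gt0.
  exists (4 * Num.sqrt Ct)^-1; split; first by rewrite invr_gt0 mulr_gt0.
  rewrite -{1}(sqr_sqrtr (ltW hCt)).
  by field; rewrite gt_eqF.
pose M := (sites N)%:R * (N.+1%:R * (2 * Ch1)).
pose C5 := 64 * M * R0 ^+ 4 / R0 ^+ 6.
pose c1 := Czeta0 / (6 * (1 + expR 1) * Ch1).
pose c2 := (sites N)%:R * (N.+1%:R * (Czeta0 * 8)).
pose c4 := (sites N)%:R * (N.+1%:R * (Ch1 * 2)).
pose D : R := (sites N + sites N)%:R.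
pose b0 := C5 + 2 * c2 + 4 * c4.
pose Cw := 1 + D * b0 ^+ 2 / (2 * l * kap0).
have M0 : 0 <= M by rewrite /M !mulr_ge0 // ltW.
have C50 : 0 <= C5 by rewrite divr_ge0 ?mulr_ge0 ?exprn_ge0 // ltW.
have D0 : 0 <= D by exact: ler0n.
have c10 : 0 < c1 by rewrite divr_gt0 // !mulr_gt0 // addr_gt0 // expR_gt0.
have lk0 : 0 <= 2 * l * kap0 by apply/ltW; rewrite mulr_gt0 // mulr_gt0.
have Cw0 : 0 < Cw.
  have b2 := sqr_ge0 b0; by rewrite ltr_pwDl // divr_ge0 // mulr_ge0.
have Q0 : 0 < 1 + 4 / q by rewrite addr_gt0 // divr_gt0.
pose A := 2 * D * C5 * tau + 1.
have DC : 0 <= 2 * D * C5 by rewrite mulr_ge0 // mulr_ge0.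
have A0 : 0 < A by rewrite ltr_wpDl // mulr_ge0 // ltW.
(* In turn: the gap below [kap0], the convergence of the remainder, the enlarged ball below
   [rho_star], and the drift of the norm of [z]. The [+ 1] in [A] keeps the divisor positive. *)
pose e1 := Num.min (Num.min (eps_star / 16) (R0 / 2))
                   (Num.min (c1 / 4) (q / 9 / A)).
(* The bound 1 lets the square in [hE] be replaced by a first power. *)
pose eta1 := Num.min 1 (q / 9 / ((1 + 4 / q) * Cw)).
have eta10 : 0 < eta1 by rewrite lt_min ltr01 /= !divr_gt0 // mulr_gt0.
case/andP: (heps_star) => s0 s1.
exists e1, eta1, (Num.sqrt Cw); split => //.
- have q9 : 0 < q / 9 by rewrite divr_gt0.
  by rewrite !lt_min (divr_gt0 s0) // (divr_gt0 R00) // (divr_gt0 c10) // divr_gt0.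
- by rewrite sqrtr_gt0.
move=> eps rho T he he1.
move=> hrho hrhoe hT hTtau hE J z w Ji J0 hz hw zb dz t Jt tT; move: he1.
rewrite /e1 !le_min => /andP[/andP[he16 heR] /andP[hec heA]].
case/andP: (he) => e0 es; have e2 := lt_trans es s1.
set x := Num.sqrt rho in hTtau *.
have x0 : 0 < x by rewrite sqrtr_gt0.
have xx : x ^+ 2 = rho by rewrite sqr_sqrtr // ltW.
have xe : x <= eps by rewrite -(@ler_pXn2r _ 2) ?nnegrE ?(ltW x0) ?(ltW e0) // xx.
move: dz; rewrite powR_invsqrt // -/x => dz.
apply: (@fixed_parameters_bound R N Czeta0 Ch1 Ct C1 eps (X1 eps) (zeta1 eps)
  (Hs eps) hN hCzeta0 hCh1 hCt e0 e2 (hzeta0 he) (hf he) (hnf he) (hXN he)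
  kap0 kap1 q l kap00 kap10 q0 q1 l0 kap_gap _ R0 M C5 c1 c2 c4 D b0 Cw
  R00 CtR0 erefl erefl erefl erefl erefl erefl erefl erefl rho T x _ _ hec hrho hrhoe
  x0 xx erefl _ _ J z w t Ji J0 hz hw zb dz Jt tT).
- by apply: hkap1; rewrite e0.
- by lra.
- apply: (@le_trans _ _ (2 * D * C5 * (eps * tau))).
    rewrite ler_wpM2l //; apply: ler_pM => //; first exact: ltW.
    by rewrite !mulr_ge0 // ltW.
  move: heA; rewrite ler_pdivlMr // /A => h; lra.
- apply: (@le_trans _ _ ((1 + 4 / q) * Cw * eta1)).
    rewrite ler_wpM2l //; first by rewrite ltW // mulr_gt0.
    have eta1_1 : eta1 <= 1 by rewrite ge_min lexx.
    have p0 : 0 <= expR (kap0 * (rho * T)) * (eps ^+ 3 / rho).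
      by rewrite mulr_ge0 ?expR_ge0 // divr_ge0 ?exprn_ge0 // ltW.
    rewrite expr2; apply: (@le_trans _ _ (eta1 * 1)); last by rewrite mulr1.
    by apply: ler_pM => //; apply: le_trans eta1_1.
  by rewrite mulrC -ler_pdivlMr ?mulr_gt0 // ge_min lexx orbT.
Qed.

End Core.

(** * The two time scales *)

Unset Implicit Arguments.

Theorem theorem7 (R : realType) (N : nat)
    (Czeta0 Ch1 Ct C1 eps_star : R)
    (X1 : R -> hpoly R N) (zeta1 Hs : R -> nat -> hpoly R N)
    (hN : (2 <= N)%N)
    (hCzeta0 : 0 < Czeta0) (hCh1 : 0 < Ch1) (hCt : 0 < Ct) (hC1 : 0 < C1)
    (heps_star : 0 < eps_star < 1 / 2)
    (hzeta0 : forall eps, 0 < eps < eps_star ->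
       classD 2 Czeta0 (2 * eps) (zeta0 N eps))
    (hh1 : forall eps, 0 < eps < eps_star ->
       exists2 h1 : nat -> hpoly R N,
         classD 4 Ch1 (2 * eps) h1 & H1 N eps = cyc (seed_sum h1))
    (hf : forall eps, 0 < eps < eps_star -> 1 < f_thr N Czeta0 eps)
    (hnf : forall eps, 0 < eps < eps_star ->
       normal_form Czeta0 Ch1 Ct eps (X1 eps) (zeta1 eps) (Hs eps))
    (hXN : forall eps, 0 < eps < eps_star ->
       XN_bound Czeta0 Ch1 C1 eps (zeta1 eps) (Hs eps)) :
  (exists eta C : R, [/\ 0 < eta, 0 < C &
     forall eps rho : R,
       0 < eps < eps_star -> 0 < rho < rho_star N Czeta0 Ch1 eps ->
       eps ^+ 3 / rho < eta -> rho <= eps ^+ 2 ->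
       forall (J : set R) (z z_a : R -> phase R N),
         open J -> is_interval J -> J 0 ->
         ham_solution (H_nf eps (zeta1 eps) (Hs eps)) J z ->
         ham_solution (ev (K_eff eps (zeta1 eps))) J z_a ->
         in_ball rho (z 0) ->
         enorm (z 0 - z_a 0) <= rho `^ (- (1 / 2)) * eps ^+ 3 ->
         forall t, J t -> `|t| <= 1 / rho ->
           enorm (z t - z_a t) <= C * rho `^ (- (1 / 2)) * eps ^+ 3])
  /\
  (forall alpha : R, 0 < alpha < 1 ->
   exists eta C : R, [/\ 0 < eta, 0 < C &
     forall eps rho : R,
       0 < eps < eps_star -> 0 < rho < rho_star N Czeta0 Ch1 eps ->
       eps `^ (3 / (1 + alpha)) / rho < eta -> rho <= eps ^+ 2 ->
       forall (J : set R) (z z_a : R -> phase R N),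
         open J -> is_interval J -> J 0 ->
         ham_solution (H_nf eps (zeta1 eps) (Hs eps)) J z ->
         ham_solution (ev (K_eff eps (zeta1 eps))) J z_a ->
         in_ball rho (z 0) ->
         enorm (z 0 - z_a 0) <= rho `^ (- (1 / 2)) * eps ^+ 3 ->
         forall t, J t ->
           `|t| <= alpha / (kappa0 C1 Ch1 eps_star * rho) * ln (1 / rho) ->
           enorm (z t - z_a t)
             <= C * rho `^ (- (1 / 2) - alpha) * eps ^+ 3]).
Proof.
case/andP: (heps_star) => s0 s1.
have key := approximation_estimate hN hCzeta0 hCh1 hCt hC1 heps_star hzeta0
  hf hnf hXN.
have kap00 := kappa0_gt0 hCh1 hC1 heps_star.
set kap := kappa0 C1 Ch1 eps_star in key kap00 *.
split=> [|alpha /andP[al0 al1]].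
  have [e1 [eta1 [C [e10 eta10 C0 H]]]] := key 1 ltr01.
  have E0 : 0 < expR kap by exact: expR_gt0.
  exists (Num.min e1 (eta1 / expR kap)), (C * expR kap); split.
  - by rewrite lt_min e10 divr_gt0.
  - by rewrite mulr_gt0.
  move=> eps rho he /andP[rho0 _]; rewrite lt_min => /andP[h1 h2] hre.
  move=> J z w Jo Ji J0 hz hw zb dz t Jt tT.
  case/andP: (he) => e0 es; have e2 := lt_trans es s1.
  have T1 : rho * (1 / rho) = 1 by rewrite mul1r divff // gt_eqF.
  have := H eps rho (1 / rho) he _ rho0 hre _ _ _ J z w Ji J0 hz hw zb dz t Jt tT.
  rewrite T1 mulr1; apply.
  (* [eps <= eps^3 / rho] because [rho <= eps^2]: the regime itself forces [eps] to be small. *)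
  - apply: ltW; apply: le_lt_trans h1.
    by rewrite ler_pdivlMr // [leRHS]exprS ler_wpM2l // ltW.
  - by rewrite divr_ge0 // ltW.
  - rewrite mulr1 -sqrtr1 ler_wsqrtr // (le_trans hre) //.
    by rewrite expr_le1 //; lra.
  - by rewrite mulrC -ler_pdivlMr // ltW.
have [al2|al2] := leP (1 / 2) alpha.
  (* Here [3 / (1 + alpha) <= 2], so [rho <= eps^2] keeps the ratio of the regime at least 1: with
     threshold 1 the regime is empty. *)
  exists 1, 1; split => // eps rho /andP[e0 es] /andP[rho0 _] h hre.
  have e2 := lt_trans es s1.
  exfalso; move: h; rewrite ltr_pdivrMr // mul1r; apply/negP; rewrite -leNgt.
  apply: le_trans hre _; rewrite -powR_mulrn ?(ltW e0) //.
  apply: ger_powR; first by rewrite e0 /=; lra.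
  by rewrite ler_pdivrMr; lra.
have tau0 : 0 < 2 * alpha / kap by rewrite divr_gt0 // mulr_gt0.
have [e1 [eta1 [C [e10 eta10 C0 H]]]] := key _ tau0.
have a10 : 0 < 1 + alpha by lra.
pose beta := 3 / (1 + alpha) - 2.
have beta0 : 0 < beta by rewrite subr_gt0 ltr_pdivlMr //; lra.
exists (Num.min 1 (Num.min eta1 (e1 `^ beta))), C; split => //.
  by rewrite !lt_min ltr01 eta10 powR_gt0.
move=> eps rho he /andP[rho0 _]; rewrite !lt_min => /and3P[h1 h2 h3] hre.
move=> J z w Jo Ji J0 hz hw zb dz t Jt tT.
case/andP: (he) => e0 es; have e2 := lt_trans es s1.
have rho1 : rho <= 1 by rewrite (le_trans hre) // expr_le1 //; lra.
have ln0 : 0 <= ln (1 / rho) by rewrite ln_ge0 // ler_pdivlMr // mul1r.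
set T := alpha / (kap * rho) * ln (1 / rho) in tT.
have kT : kap * (rho * T) = alpha * ln (1 / rho).
  by rewrite /T; field; rewrite !gt_eqF.
(* The time scale is the one at which the growth factor equals [rho^(-alpha)]. *)
have EE : expR (kap * (rho * T)) = rho `^ (- alpha).
  by rewrite kT /powR gt_eqF // div1r lnV ?posrE // mulrN mulNr.
set Y := eps `^ (3 / (1 + alpha)) / rho in h1 h2 h3.
have Y0 : 0 < Y by rewrite divr_gt0 // powR_gt0.
(* This identity explains the exponent [3 / (1 + alpha)] of the regime. *)
have YE : rho `^ (- alpha) * (eps ^+ 3 / rho) = Y `^ (1 + alpha).
  rewrite /Y powRM ?invr_ge0 ?powR_ge0 ?(ltW rho0) // -powRrM divfK ?gt_eqF //.
  rewrite powR_mulrn ?(ltW e0) // -powR_inv1 ?(ltW rho0) // -powRrM.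
  rewrite mulN1r opprD [rho `^ (_ + _)]powRD; first by ring.
  by rewrite (gt_eqF rho0) implybT.
have := H eps rho T he _ rho0 hre _ _ _ J z w Ji J0 hz hw zb dz t Jt tT.
rewrite EE YE -[C * _ * _]mulrA -powRD; last by rewrite (gt_eqF rho0) implybT.
rewrite [- alpha + _]addrC; apply.
- rewrite leNgt; apply/negP => e1e.
  move: h3; apply/negP; rewrite -leNgt.
  apply: (@le_trans _ _ (eps `^ beta)).
    by apply: ge0_ler_powR; rewrite ?nnegrE ltW.
  rewrite /Y ler_pdivlMr //.
  apply: (@le_trans _ _ (eps `^ beta * eps ^+ 2)).
    by rewrite ler_wpM2l // powR_ge0.
  rewrite -powR_mulrn ?(ltW e0) // -powRD /beta ?subrK //.
  by rewrite (gt_eqF e0) implybT.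
- have kr : 0 < kap * rho := mulr_gt0 kap00 rho0.
  by rewrite mulr_ge0 // divr_ge0 ?(ltW al0) ?(ltW kr).
- set x := Num.sqrt rho.
  have x0 : 0 < x by rewrite sqrtr_gt0.
  have xx : x ^+ 2 = rho by rewrite sqr_sqrtr // ltW.
  (* [ln (1 / rho) = 2 ln (1 / x)] and [ln y < y]; hence the value [2 * alpha / kap] given to
     [tau]. *)
  have lx : ln (1 / rho) <= 2 / x.
    have -> : 1 / rho = (x^-1) ^+ 2 by rewrite exprVn xx div1r.
    rewrite lnXn ?invr_gt0 // -[leLHS]mulr_natl ler_wpM2l //.
    by rewrite ltW // ln_sublinear // invr_gt0.
  have -> : x * (rho * T) = alpha / kap * (x * ln (1 / rho)).
    by rewrite /T; field; rewrite !gt_eqF.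
  rewrite [leRHS](_ : _ = alpha / kap * 2); last by ring.
  have ak : 0 <= alpha / kap by apply/ltW/divr_gt0.
  rewrite ler_wpM2l //.
  by rewrite mulrC -ler_pdivlMr.
(* Since [Y < 1], its power [1 + alpha] is at most [Y]. *)
- apply: le_trans (ltW h2); rewrite -[leRHS]powRr1 ?(ltW Y0) //.
  by apply: ger_powR; [rewrite Y0 ltW|rewrite lerDl ltW].
Qed.
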